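(* For every integer $n\ge2$, the limit space $X_n$ of the $n$-rabbit replacement system is an $n$-regular rabbit.
   Context: Replacement systems and limit spaces. A graph is a finite directed multigraph (loops allowed), each edge having an initial and a terminal vertex. A replacement system consists of a base graph and, for each color $c$ in a finite set, a replacement graph $R_c$ with two distinguished distinct vertices $\iota_c,\tau_c$, all graphs being edge-colored by the given colors. A $c$-colored edge $e$ of a graph is expanded by replacing $e$ by a copy of $R_c$, identifying the initial and terminal vertices of $e$ with $\iota_c$ and $\tau_c$. A graph expansion is a graph obtained from the base graph by finitely many expansions. Edges of graph expansions are named by finite words: edges of the base graph are one-letter words and, when an edge $f$ of color $c$ is expanded, the new edges are $fe$ for $e$ an edge of $R_c$ (with the color of $e$). The symbol space $\mathfrak{C}$ is the set of infinite words each of whose nonempty finite prefixes is an edge of some graph expansion, with the subspace topology from the product topology on infinite words in the finite alphabet of all edges of the base and replacement graphs. The gluing relation is $x_1x_2\cdots\sim y_1y_2\cdots$ if and only if, for all large enough $k$, the edges $x_1\cdots x_k$ and $y_1\cdots y_k$ are incident (share a vertex) in all graph expansions that feature them both. For the system considered here it is an equivalence relation, and the limit space is the quotient $\mathfrak{C}/\sim$. The $n$-rabbit replacement system has a single color. Its base graph has one vertex and $n$ loops. Its replacement graph has three vertices $\iota,m,\tau$, an edge from $\iota$ to $m$, an edge from $m$ to $\tau$, and $n-1$ loops at $m$. Rabbits. A Peano continuum is a compact, metrizable, connected, locally connected space; arcs and circles in it are subsets homeomorphic to $[0,1]$ and $\mathbf{S}^1$; the order of a point is the number of connected components of its complement;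 cut points are points of order at least $2$. A rabbit is a Peano continuum $X$ such that: (1) the set of points belonging to at least two distinct circles is dense; (2) for any distinct circles $C,C'$ there is a cut point $x$ such that $C\setminus\{x\}$ and $C'\setminus\{x\}$ lie in distinct connected components of $X\setminus\{x\}$; (3) for any two points each of which belongs to some circle, every arc between them is included in a union of finitely many circles. It is $n$-regular if all its cut points have order $n$. *)

(* Defs.v *)
From HB Require Import structures.
From mathcomp Require Import all_boot all_order all_algebra.
From mathcomp Require Import generic_quotient.
From mathcomp Require Import all_classical all_reals all_analysis.

Set Implicit Arguments.
Unset Strict Implicit.
Unset Printing Implicit Defensive.

Import Order.TTheory GRing.Theory Num.Theory.
Import numFieldNormedType.Exports.

Local Open Scope classical_set_scope.
Local Open Scope ring_scope.
Local Open Scope card_scope.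
Local Open Scope quotient_scope.

Record graph (K : Type) := Graph {
  vertex : finType;
  edge : finType;
  init : edge -> vertex;
  term : edge -> vertex;
  color : edge -> K }.

Definition incident (K : Type) (G : graph K) (e f : edge G) : Prop :=
  exists v : vertex G,
    v \in [:: init e; term e] /\ v \in [:: init f; term f].

Record replacement_system := ReplacementSystem {
  colors : finType;
  base : graph colors;
  repl : colors -> graph colors;
  iota_vertex : forall c, vertex (repl c);
  tau_vertex : forall c, vertex (repl c);
  iota_neq_tau : forall c, iota_vertex c != tau_vertex c }.

Section Expansions.
Variable S : replacement_system.

Definition alphabet : finType :=
  (edge (base S) + {c : colors S & edge (repl c)})%type.

Record named_graph := NamedGraph {
  ngraph :> graph (colors S);
  name : edge ngraph -> seq alphabet }.

Definition base_named : named_graph :=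
  @NamedGraph (base S) (fun e => [:: inl e]).

Definition interior_vertex (c : colors S) : pred (vertex (repl c)) :=
  [pred v | (v != iota_vertex c) && (v != tau_vertex c)].
Arguments interior_vertex : clear implicits.

Section Expand.
Variables (G : named_graph) (e : edge G).
Let c := color e.

(* The expansion at [e] keeps all vertices of [G] and adds the vertices of [R_c]
   other than [iota_c] and [tau_c], which are identified with the ends of [e]. *)
Definition expand_vertex : finType :=
  (vertex G + {v : vertex (repl c) | interior_vertex c v})%type.

Definition attach (v : vertex (repl c)) : expand_vertex :=
  if insub v is Some u then inr u
  else inl (if v == iota_vertex c then init e else term e).

Definition expand_edge : finType :=
  ({f : edge G | f != e} + edge (repl c))%type.

Definition expand : named_graph :=
  @NamedGraph
    (@Graph _ expand_vertex expand_edge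
      (fun f => match f with
                | inl g => inl (init (val g))
                | inr a => attach (init a)
                end)
      (fun f => match f with
                | inl g => inl (term (val g))
                | inr a => attach (term a)
                end)
      (fun f => match f with
                | inl g => color (val g)
                | inr a => color a
                end))
    (fun f => match f with
              | inl g => name (val g)
              | inr a => rcons (name e) (inr (Tagged (fun d => edge (repl d)) a))
              end).

End Expand.

Inductive graph_expansion : named_graph -> Prop :=
  | expansion_base : graph_expansion base_named
  | expansion_step (G : named_graph) (e : edge G) :
      graph_expansion G -> graph_expansion (expand e).

Definition edge_word (w : seq alphabet) : Prop :=
  exists G : named_graph, graph_expansion G /\ exists e : edge G, name e = w.

Definition infinite_words : topologicalType :=
  prod_topology (fun _ : nat => discrete_topology alphabet).

Definition prefix_word (x : infinite_words) (k : nat) : seq alphabet := mkseq x k.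

Definition symbol_space : set infinite_words :=
  [set x | forall k, (0 < k)%N -> edge_word (prefix_word x k)].

Definition gluing (x y : symbol_space) : Prop :=
  exists N, forall k, (N <= k)%N ->
  forall G : named_graph, graph_expansion G -> forall e f : edge G,
    name e = prefix_word (val x) k -> name f = prefix_word (val y) k ->
    incident e f.

(* The quotient is the set of gluing classes [[set y | gluing x y]]: two points
   are identified when they have the same class.  When [gluing] is an
   equivalence relation this means exactly that [gluing x y] holds; going through
   the classes provides a quotient type without a proof of that fact. *)
Definition gluing_class (x : symbol_space) : set symbol_space :=
  [set y | gluing x y].

Definition same_class : rel symbol_space :=
  fun x y => `[< gluing_class x = gluing_class y >].

Lemma same_class_refl : reflexive same_class.
Proof. by move=> x; apply/asboolP. Qed.

Lemma same_class_sym : symmetric same_class.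
Proof. by move=> x y; apply/asboolP/asboolP. Qed.

Lemma same_class_trans : transitive same_class.
Proof. by move=> y x z /asboolP xy /asboolP yz; apply/asboolP; rewrite xy. Qed.

Definition gluing_equiv : equiv_rel symbol_space :=
  EquivRel same_class same_class_refl same_class_sym same_class_trans.

Definition limit_space : topologicalType :=
  quotient_topology {eq_quot gluing_equiv}.

End Expansions.

Definition rabbit_base (n : nat) : graph unit :=
  @Graph unit unit 'I_n (fun=> tt) (fun=> tt) (fun=> tt).

(* [Some false], [None] and [Some true] are the vertices [iota], [m] and [tau];
   [inl false] and [inl true] are the edges from [iota] to [m] and from [m] to
   [tau], and the edges [inr i] are the loops at [m]. *)
Definition rabbit_repl (n : nat) : graph unit :=
  @Graph unit (option bool) (bool + 'I_n.-1)%type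
    (fun e => if e is inl false then Some false else None)
    (fun e => if e is inl true then Some true else None)
    (fun=> tt).

Definition rabbit_system (n : nat) : replacement_system :=
  @ReplacementSystem unit (rabbit_base n) (fun=> rabbit_repl n)
    (fun=> Some false) (fun=> Some true) (fun=> isT).

Section Topology.
Variables (R : realType) (T : topologicalType).

Definition metrizable : Prop :=
  exists d : T -> T -> R,
    [/\ (forall x y, d x y = 0 <-> x = y),
        (forall x y, d x y = d y x),
        (forall x y z, d x z <= d x y + d y z) &
        (forall (x : T) (A : set T), nbhs x A <->
           exists2 r : R, 0 < r & [set y | d x y < r] `<=` A)].

Definition locally_connected : Prop :=
  forall (x : T) (A : set T), nbhs x A ->
    exists V : set T, [/\ open V, V x, connected V & V `<=` A].

Definition peano_continuum : Prop :=
  [/\ compact [set: T], metrizable, connected [set: T] & locally_connected].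

(* Mutually inverse homeomorphisms between the subspaces [A] and [B]; the values
   of [f] outside [A] and of [g] outside [B] are irrelevant. *)
Definition homeo_between (U V : topologicalType) (A : set U) (B : set V)
    (f : U -> V) (g : V -> U) : Prop :=
  [/\ {within A, continuous f}, {within B, continuous g},
      (forall x, A x -> B (f x) /\ g (f x) = x) &
      (forall y, B y -> A (g y) /\ f (g y) = y)].

Definition unit_circle : set (R * R) := [set p | p.1 ^+ 2 + p.2 ^+ 2 = 1].

Definition is_circle (C : set T) : Prop :=
  exists f g, homeo_between unit_circle C f g.

Definition arc_between (x y : T) (A : set T) : Prop :=
  exists (f : R -> T) (g : T -> R),
    [/\ homeo_between [set t : R | 0 <= t <= 1] A f g, f 0 = x & f 1 = y].

Definition complement_components (x : T) : set (set T) :=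
  [set connected_component (~` [set x]) y | y in ~` [set x]].

Definition has_order (x : T) (n : nat) : Prop :=
  complement_components x #= `I_n.

Definition cut_point (x : T) : Prop := `I_2 #<= complement_components x.

Definition rabbit : Prop :=
  [/\ peano_continuum,
      dense [set x : T | exists C C',
        [/\ is_circle C, is_circle C', C <> C', C x & C' x]],
      (forall C C', is_circle C -> is_circle C' -> C <> C' ->
        exists x K K', [/\ cut_point x,
          complement_components x K, complement_components x K', K <> K' &
          (C `\ x `<=` K) /\ (C' `\ x `<=` K')]) &
      (forall x y, (exists2 C, is_circle C & C x) ->
                   (exists2 C, is_circle C & C y) ->
        forall A, arc_between x y A ->
        exists F : set (set T), [/\ finite_set F,
          (forall C, F C -> is_circle C) & A `<=` \bigcup_(C in F) C])].

Definition regular_rabbit (n : nat) : Prop :=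
  rabbit /\ forall x, cut_point x -> has_order x n.

End Topology.

(* Main.v *)
Require Import Defs.
From mathcomp Require Import all_boot all_order all_algebra.
From mathcomp Require Import generic_quotient.
From mathcomp Require Import all_classical all_reals all_analysis.
From mathcomp Require Import zify lra ring.

Set Implicit Arguments.
Unset Strict Implicit.
Unset Printing Implicit Defensive.

Import Order.TTheory GRing.Theory Num.Theory.
Import numFieldNormedType.Exports.

Local Open Scope classical_set_scope.
Local Open Scope ring_scope.
Local Open Scope card_scope.
Local Open Scope quotient_scope.

(** The limit space is a tree of circles. The edges of the graph expansions are
    named by words, and the vertex created by the expansion of the edge [u] will
    be named [u] too, the empty word being the base vertex. A word [w] that ends
    with a loop yields a circle: the points whose address continues [w] with the
    halves of edges only ([iota] to [m], [m] to [tau]), read as binary digits of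
    a point of R/Z. The coordinate [limit_coord w] retracts the whole space onto
    this circle: an address that leaves the circle at a dyadic point through
    another loop stops there, and an address that does not begin with [w] goes
    to the root of the circle.

    The coordinates are continuous, and two addresses are glued if and only if
    all their coordinates agree ([gluing_stream_coord]). So gluing is an
    equivalence relation, and the limit space is a compact subspace of a countable
    product of circles; this makes it metrizable. A cell, made of the
    points whose address has a given prefix, is connected because its children
    share a vertex ([cell_connected]), and the cells around a point are small
    connected neighbourhoods ([cells_small]).

    For a loop word [rcons u c], the set [branch (rcons u c)] where the
    coordinate is not that of the root is open, and the vertex [u] is its only
    boundary point, so that a connected set without [u] lies on one side
    ([connected_branch]). Conversely, a climb along the ends of edges joins any point,
    off a given point [p], to the base vertex or to a branch attached
    at [p] ([joined_point]). Hence the complement of a vertex has exactly [n]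
    components, and the complement of any other point is connected.

    A topological circle minus a point is connected, so the branches confine it
    to one circle of the tree, and it is the whole of that circle because no
    circle is homeomorphic to a proper subset of a circle ([is_circleP]).
    Two circles of the tree are separated by the root of one of them. An arc
    passes only once through a vertex, so it cannot make an excursion into a
    branch that contains none of its ends ([arc_through]); this leaves only the
    finitely many circles on the way between its ends. *)

(** * Metrizability of compact spaces *)

Lemma pow_half_lt (R : realType) (e : R) : 0 < e -> exists k, 2^-1 ^+ k < e.
Proof.
move=> e0; have cv : (fun k => 2^-1 ^+ k : R) @ \oo --> (0 : R).
  by apply: cvg_expr; rewrite ger0_norm ?invr_ge0 // invf_lt1 // ltr1n.
have /cvgrPdist_lt /(_ _ e0) [k _ /(_ k (leqnn k))] := cv.
by rewrite sub0r normrN ger0_norm ?exprn_ge0 ?invr_ge0 //; exists k.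
Qed.

Section Metrizability.
Variables (R : realType) (T : topologicalType) (f : nat -> T -> R).
Hypothesis compactT : compact [set: T].
Hypothesis f_cts : forall k, continuous (f k).
Hypothesis f_le1 : forall k x, `|f k x| <= 1.
Hypothesis f_sep : forall x y, (forall k, f k x = f k y) -> x = y.

Let term k x y : R := 2^-1 ^+ k * `|f k x - f k y|.

Let sup_dist x y : R := sup [set term k x y | k in [set: nat]].

Let pow_ge0 k : 0 <= 2^-1 ^+ k :> R.
Proof. by rewrite exprn_ge0 ?invr_ge0. Qed.

Let term_ge0 k x y : 0 <= term k x y.
Proof. by rewrite mulr_ge0. Qed.

Let term_le k x y : term k x y <= 2^-1 ^+ k * 2.
Proof.
rewrite ler_wpM2l //; apply: le_trans (ler_normB _ _) _.
by have := f_le1 k x; have := f_le1 k y; lra.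
Qed.

Let term_le_dist k x y : term k x y <= sup_dist x y.
Proof.
apply: ub_le_sup; last by exists k.
exists 2 => _ [j _ <-]; apply: le_trans (term_le _ _ _) _.
by rewrite ler_piMl // exprn_ile1 ?invr_ge0 ?invf_le1 ?ler1n.
Qed.

Let dist_le x y r : (forall k, term k x y <= r) -> sup_dist x y <= r.
Proof.
move=> H; apply: ge_sup; first by exists (term 0 x y), 0%N.
by move=> _ [k _ <-].
Qed.

Let dist_ball x r : 0 < r -> nbhs x [set y | sup_dist x y < r].
Proof.
move=> r0; have [m mr] := @pow_half_lt R (r / 4) (ltac:(by rewrite divr_gt0)).
have : \forall y \near x, forall k, (k < m)%N -> term k x y <= r / 2.
  elim: m {mr} => [|m IH]; first by near=> y.
  have mx : \forall y \near x, term m x y <= r / 2.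
    have /cvgrPdist_lt /(_ (r / 2)) := @f_cts m x.
    rewrite divr_gt0 // => /(_ isT); apply: filterS => y xy.
    apply: le_trans (ltW xy); rewrite ler_piMl //.
    by rewrite exprn_ile1 ?invr_ge0 ?invf_le1 ?ler1n.
  apply: filterS (filterI IH mx) => y [xy ym] k.
  by rewrite ltnS leq_eqVlt => /predU1P[->|/xy].
apply: filterS => y xy /=; apply: (@le_lt_trans _ _ (r / 2)); last by lra.
apply: dist_le => k; have [/xy//|mk] := ltnP k m.
apply: le_trans (term_le _ _ _) _.
have : 2^-1 ^+ k <= 2^-1 ^+ m :> R.
  by rewrite ler_wiXn2l ?invr_ge0 ?invf_le1 ?ler1n.
lra.
Unshelve. all: by end_near. Qed.

Let dist_nbhs x A : nbhs x A ->
  exists2 r : R, 0 < r & [set y | sup_dist x y < r] `<=` A.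
Proof.
move=> xA; have /compact_near_coveringP cov := compactT.
(* Near each [y], and for all small enough radii [r], the ball of radius [r]
   either is not entered or lies in [A]; compactness makes such an [r]
   uniform. *)
have := cov R 0^'+ (fun r y => sup_dist x y < r -> A y) _.
case=> [y _|/= e e0 eA]; last first.
  by exists (e / 2) => [|y]; [rewrite /= divr_gt0|apply: eA => //=;
    rewrite ?divr_gt0 // sub0r normrN gtr0_norm ?divr_gt0 //; lra].
have [[k yk]|/forallNP xy] := pselect (exists k, f k x <> f k y); last first.
  have -> : y = x.
    by apply: f_sep => k; apply/esym; apply: contrapT; exact: xy.
  exists (A, setT) => [|[z r] [/= Az _] _ //]; split=> //=.
  exact: filterT.
pose d := `|f k x - f k y|.
have d0 : 0 < d by rewrite normr_gt0 subr_eq0; exact/eqP.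
exists ([set z | `|f k y - f k z| < d / 2], [set r | r < 2^-1 ^+ k * (d / 2)]).
  split=> /=; last by apply: nbhs_right_lt; rewrite mulr_gt0 ?divr_gt0 ?exprn_gt0.
  by have /cvgrPdist_lt /(_ (d / 2)) := @f_cts k y; apply; rewrite divr_gt0.
move=> [z r] [/= zy rd] xz; exfalso.
have : 2^-1 ^+ k * (d / 2) <= term k x z.
  rewrite ler_wpM2l //.
  have : d <= `|f k x - f k z| + `|f k y - f k z|.
    by rewrite (distrC (f k y)) /d; exact: ler_distD.
  lra.
by have := term_le_dist k x z; lra.
Qed.

(** The distance is the supremum of the [2^-1 ^+ k * `|f k x - f k y|]. Only
    finitely many of these terms can exceed a given positive bound, so balls
    are open; compactness makes the balls at a point a basis of its
    neighbourhoods. *)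
Lemma metrizable_of_separating : metrizable R T.
Proof.
exists sup_dist; split=> [x y|x y|x y z|x A].
- split=> [xy|->]; last first.
    apply/eqP; rewrite eq_le dist_le => [|k];
      last by rewrite /term subrr normr0 mulr0.
    exact: le_trans (term_ge0 0 y y) (term_le_dist 0 y y).
  apply: f_sep => k; apply/eqP; rewrite -subr_eq0 -normr_le0.
  have := term_le_dist k x y; rewrite xy /term (pmulr_rle0 _ (exprn_gt0 _ _)) //.
- by rewrite /sup_dist; congr sup; apply/seteqP; split=> _ [k _ <-]; exists k => //;
    rewrite /term distrC.
- apply: dist_le => k; apply: (@le_trans _ _ (term k x y + term k y z)).
    by rewrite -mulrDr ler_wpM2l // ler_distD.
  by apply: lerD; exact: term_le_dist.
- split=> [|[r r0]]; first exact: dist_nbhs.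
  by move=> BA; apply: filterS BA _; exact: dist_ball.
Qed.

End Metrizability.

(** * Local connectedness and components *)

Section GeneralTopology.
Variable T : topologicalType.

(** The connected component of [x] in the interior of [A] will do: it is open
    because each of its points has a connected neighbourhood inside that
    interior. *)
Lemma locally_connected_of_nbhs :
  (forall (x : T) A, nbhs x A -> exists N, [/\ nbhs x N, connected N & N `<=` A]) ->
  locally_connected T.
Proof.
move=> H x A xA; exists (connected_component A° x); split.
- rewrite openE => y Cy.
  have Ay : nbhs y A°.
    by apply: open_nbhs_nbhs; split; [exact: open_interior|exact:
      connected_component_sub Cy].
  have [N [yN cN NA]] := H y _ Ay.
  apply: filterS (yN) => z Nz; apply: connected_component_trans Cy _.
  by exists N => //; split=> //; exact: nbhs_singleton yN.
- exact: connected_component_refl.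
- exact: component_connected.
- by move=> y /connected_component_sub /interior_subset.
Qed.

(** Since [p] is the only possible boundary point of [K], the trace of [K] on
    [A] is both open and closed in [A]. *)
Lemma connected_boundary (A K : set T) p : open K -> closed (p |` K) ->
  connected A -> A `&` K !=set0 -> ~ A p -> A `<=` K.
Proof.
move=> oK cK cA AK Ap; have <- : A `&` K = A.
  apply: cA => //; first by exists K.
  exists (p |` K) => //; apply/seteqP; split=> y [Ay]; first by split=> //; right.
  by case=> [yp|//]; case: Ap; rewrite -yp.
by move=> y [].
Qed.

(** The complement of one [K i] in the complement of [x] is the union of the
    others, hence open; so [K i] is clopen there and no component is larger
    than it. *)
Lemma has_order_of_components (x : T) n (K : 'I_n -> set T) (b : 'I_n -> T) :
  (forall i, open (K i)) -> (forall i j, K i `&` K j !=set0 -> i = j) ->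
  (forall i, K i (b i)) ->
  (forall i y, K i y -> connected_component (~` [set x]) (b i) y) ->
  ~` [set x] = \bigcup_i K i -> has_order x n.
Proof.
move=> oK dK Kb bK xK.
have bC i : (~` [set x]) (b i) by rewrite xK; exists i.
have compE i : connected_component (~` [set x]) (b i) = K i.
  apply/seteqP; split; last exact: bK.
  set D := connected_component _ _.
  suff <- : D `&` K i = D by apply: subIsetr.
  apply: (@component_connected _ (~` [set x]) (b i)).
  - by exists (b i); split=> //; exact: connected_component_refl.
  - by exists (K i).
  - exists (~` \bigcup_(j in [set j | j != i]) K j).
      by apply: open_closedC; apply: bigcup_open.
    apply/seteqP; split=> y [Dy].
      move=> Kiy; split=> // -[j /= /eqP ji Kjy]; apply: ji.
      by apply: dK; exists y.
    move=> nK; split=> //; have := connected_component_sub Dy.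
    rewrite xK => -[j _ Kjy]; have [<-//|ji] := eqVneq j i.
    by case: nK; exists j.
rewrite /has_order; have -> : complement_components x = range K; last first.
  rewrite (card_eqr card_II); apply: inj_card_eq => i j _ _ Kij.
  by apply: dK; exists (b i); split=> //; rewrite -Kij.
apply/seteqP; split=> [_ [y xy <-]|_ [i _ <-]]; last by exists (b i).
have : (~` [set x]) y by [].
rewrite {1}xK => -[i _ Kiy].
by exists i => //; rewrite -compE; apply: same_connected_component; exact: bK.
Qed.

End GeneralTopology.

Lemma has_order_of_finite_components (T : topologicalType) (x : T) (I : finType)
    (K : I -> set T) (b : I -> T) :
  (forall i, open (K i)) -> (forall i j, K i `&` K j !=set0 -> i = j) ->
  (forall i, K i (b i)) ->
  (forall i y, K i y -> connected_component (~` [set x]) (b i) y) ->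
  ~` [set x] = \bigcup_i K i -> has_order x #|I|.
Proof.
move=> oK dK Kb bK xK.
apply: (@has_order_of_components _ _ _ (K \o enum_val) (b \o enum_val)) => //=.
- by move=> i j /dK /enum_val_inj.
- by move=> i y; exact: bK.
- rewrite xK; apply/seteqP; split=> z [i _ Kz]; last by exists (enum_val i).
  by exists (enum_rank i) => //=; rewrite enum_rankK.
Qed.

(** * The unit circle *)

Section CirclePoint.
Variable R : realType.

Definition circle_point (t : R) : R * R := (cos (2 * pi * t), sin (2 * pi * t)).

Lemma circle_point_unit t : @unit_circle R (circle_point t).
Proof. by rewrite /unit_circle /= cos2Dsin2. Qed.

Lemma circle_point_bool (d : bool) : circle_point d%:R = circle_point 0.
Proof.
by case: d => //=; rewrite /circle_point mulr1 mulr0 mulrC mulr_natr cos2pi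
  sin2pi cos0 sin0.
Qed.

Lemma cos_eq1 (x : R) : 0 <= x <= 2 * pi -> cos x = 1 -> x = 0 \/ x = 2 * pi.
Proof.
move=> x02 cx1; have p0 := @pi_ge0 R; have [xpi|pix] := lerP x pi.
  left; apply: cos_inj; rewrite ?in_itv /= ?lexx ?p0 ?cos0 //.
  by case/andP: x02 => ->.
right; have E : 2 * pi - x = 0.
  apply: cos_inj; rewrite ?in_itv /= ?lexx ?p0 ?cos0 //.
    by case/andP: x02 => ? ?; apply/andP; split; lra.
  by rewrite cosB mulr_natl cos2pi sin2pi cx1 mul0r mulr1 addr0.
lra.
Qed.

Lemma circle_point_inj s t : 0 <= s <= 1 -> 0 <= t <= 1 ->
  circle_point s = circle_point t ->
  s = t \/ exists d : bool, s = d%:R /\ t = (~~ d)%:R.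
Proof.
wlog st : s t / s <= t.
  move=> W s01 t01 E; have [st|ts] := lerP s t; first exact: W.
  have [->|[d [-> ->]]] := W _ _ (ltW ts) t01 s01 (esym E); first by left.
  by right; exists (~~ d); rewrite negbK.
move=> s01 t01 [cE sE].
have p0 := @pi_gt0 R.
have : cos (2 * pi * (t - s)) = 1.
  by rewrite mulrBr cosB cE sE -!expr2 cos2Dsin2.
have ts1 : t - s <= 1 by lra.
move=> /cos_eq1[||E]; last 2 first.
- left; have /eqP : 2 * pi * (t - s) = 0 by [].
  by rewrite !mulf_eq0 pnatr_eq0 (gt_eqF p0) /= subr_eq0 => /eqP.
- right; exists false => /=.
  have : t - s = 1.
    by apply: (@mulfI _ (2 * pi)); [rewrite mulf_neq0 ?gt_eqF|rewrite mulr1].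
  lra.
- apply/andP; split; first by rewrite !mulr_ge0 ?(ltW p0) // subr_ge0.
  by rewrite ler_piMr // mulr_ge0 // ltW.
Qed.

Lemma circle_point_onto p : @unit_circle R p ->
  exists2 t, 0 <= t <= 1 & circle_point t = p.
Proof.
case: p => c s; rewrite /unit_circle /= => cs1; have p0 := @pi_gt0 R.
have c11 : -1 <= c <= 1.
  by rewrite -ler_norml -(@ler_sqr _ `|c| 1) ?nnegrE // expr1n real_normK
    ?num_real //;
    rewrite -cs1 lerDl sqr_ge0.
have a0 := acos_ge0 c11; have api := acos_lepi c11.
have sE : sin (acos c) = `|s|.
  by rewrite sin_acos // -(sqrtr_sqr s); congr Num.sqrt; lra.
pose t := acos c / (2 * pi).
have p20 : 2 * pi != 0 :> R by apply: lt0r_neq0; rewrite mulr_gt0.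
have tE : 2 * pi * t = acos c by rewrite /t mulrCA divff // mulr1.
have t02 : 0 <= t <= 1.
  by rewrite divr_ge0 ?mulr_ge0 ?(ltW p0) //= ler_pdivrMr ?mulr_gt0 // mul1r; lra.
have [s0|s0] := lerP 0 s.
  by exists t => //; rewrite /circle_point tE acosK ?in_itv //= sE ger0_norm.
exists (1 - t); first lra.
rewrite /circle_point mulrBr tE mulr1 cosB sinB mulr_natl cos2pi sin2pi.
rewrite !mul0r !mul1r addr0 sub0r sE acosK ?in_itv //= ltr0_norm //.
by rewrite opprK.
Qed.

Lemma circle_point_continuous : continuous circle_point.
Proof.
move=> t; have mt : 2 * pi * s @[s --> t] --> 2 * pi * t.
  by apply: cvgM; [exact: cvg_cst|exact: cvg_id].
apply: (@cvg_pair _ _ _ (nbhs t) (nbhs (cos (2 * pi * t)))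
  (nbhs (sin (2 * pi * t)))).
- by apply: continuous_cvg mt; exact: continuous_cos.
- by apply: continuous_cvg mt; exact: continuous_sin.
Qed.

End CirclePoint.

(** * Topological circles *)

Lemma homeo_between_sym (U V : topologicalType) (A : set U) (B : set V) f g :
  homeo_between A B f g -> homeo_between B A g f.
Proof. by case. Qed.

Lemma homeo_image (U V : topologicalType) (A : set U) (B : set V) f g (A' : set U) :
  homeo_between A B f g -> A' `<=` A -> connected A' -> connected (f @` A').
Proof.
move=> [fc _ _ _] A'A cA'; apply: connected_continuous_connected cA' _.
exact: continuous_subspaceW fc.
Qed.

(** The preimage of a closed set by the inverse is the image of a compact set.
    The point [x0] is the value of the inverse outside [f @` A]. *)
Lemma compact_homeo (T V : topologicalType) (A : set T) (f : T -> V) (x0 : T) :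
  hausdorff_space V -> compact A -> continuous f ->
  (forall x y, A x -> A y -> f x = f y -> x = y) ->
  exists g, homeo_between A (f @` A) f g.
Proof.
move=> hV cA fc finj.
have inv v : exists x, (f @` A) v -> A x /\ f x = v.
  have [[x Ax <-]|nv] := pselect ((f @` A) v); first by exists x.
  by exists x0.
have [g gP] := choice inv.
have gK x : A x -> g (f x) = x.
  by move=> Ax; have [|Ag fg] := gP (f x); [exists x|exact: finj].
exists g; split=> [||x Ax|v /gP[]//].
- exact: continuous_subspaceT.
- apply/continuous_closedP => F cF.
  apply/closed_subspaceP; exists (f @` (A `&` F)).
    apply: compact_closed hV _; apply: continuous_compact.
      exact: continuous_subspaceT.
    exact: compact_closedI.
  apply/seteqP; split=> [_ [[x [Ax Fx] <-] fAx]|v [Fv [x Ax xv]]].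
    by split=> //; rewrite /preimage /from_subspace /= gK.
  split; last by exists x.
  by exists x => //; split=> //; rewrite -(gK x Ax) xv.
- by split; [exists x|exact: gK].
Qed.

Section Circles.
Variable R : realType.
Notation circle_point := (@circle_point R).
Notation unit_circle := (@unit_circle R).

Lemma circle_pointD s t : circle_point (s + t) =
  ((circle_point s).1 * (circle_point t).1 - (circle_point s).2 * (circle_point t).2,
   (circle_point s).2 * (circle_point t).1 + (circle_point s).1 * (circle_point t).2).
Proof. by rewrite /circle_point mulrDr cosD sinD. Qed.

Lemma unit_circle_connected : connected unit_circle.
Proof.
have -> : unit_circle = circle_point @` `[0, 1].
  apply/seteqP; split=> [p /circle_point_onto[t t01 <-]|_ [t _ <-]].
    by exists t => //=; rewrite in_itv.
  exact: circle_point_unit.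
apply: connected_continuous_connected; first exact: segment_connected.
by apply: continuous_subspaceT; exact: circle_point_continuous.
Qed.

(** Up to a rotation, the unit circle minus a point is the image of an open
    interval of angles. *)
Lemma unit_circleD1_connected q : connected (unit_circle `\ q).
Proof.
have [/circle_point_onto[s _ <-]|nq] := pselect (unit_circle q); last first.
  have -> : unit_circle `\ q = unit_circle; last exact: unit_circle_connected.
  by apply/seteqP; split=> [p []//|p up]; split=> // pq; apply: nq; rewrite -pq.
have -> : unit_circle `\ circle_point s = (fun t => circle_point (s + t)) @` `]0, 1[.
  apply/seteqP; split=> [p [up ps]|_ [t t01 <-]].
    have us := circle_point_unit s.
    have [t t01 tE] : exists2 t, 0 <= t <= 1 & circle_point (s + t) = p.
      pose a := circle_point s.
      (* The rotation of [p] by the angle opposite to that of [a]. *)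
      have /circle_point_onto[t t01 tE] :
          unit_circle (p.1 * a.1 + p.2 * a.2, p.2 * a.1 - p.1 * a.2).
        move: up us; rewrite /unit_circle /= -/a => up us.
        have -> : (p.1 * a.1 + p.2 * a.2) ^+ 2 + (p.2 * a.1 - p.1 * a.2) ^+ 2 =
          (p.1 ^+ 2 + p.2 ^+ 2) * (a.1 ^+ 2 + a.2 ^+ 2) by ring.
        by rewrite up us mulr1.
      exists t => //; rewrite circle_pointD tE -/a.
      have : a.1 ^+ 2 + a.2 ^+ 2 = 1 by exact: us.
      move: a (p) {us tE} => [a1 a2] [p1 p2] /= ua; congr pair.
        by rewrite -[RHS]mulr1 -[in RHS]ua; ring.
      by rewrite -[RHS]mulr1 -[in RHS]ua; ring.
    exists t => //=; rewrite in_itv /= !lt_neqAle.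
    case/andP: t01 => -> ->; rewrite !andbT; apply/andP; split; apply/eqP => t0.
      by apply: ps; rewrite -tE -t0 addr0.
    have c1 : circle_point 1 = circle_point 0 by exact: (circle_point_bool R true).
    by apply: ps; rewrite -tE t0 /= circle_pointD c1 -circle_pointD addr0.
  rewrite /= in_itv /= in t01; split; first exact: circle_point_unit.
  move=> E; have : circle_point t = circle_point 0.
    have -> : t = (s + t) + - s by rewrite addrC addKr.
    by rewrite circle_pointD -[circle_point (s + t)]/_ E -circle_pointD subrr.
  move=> /circle_point_inj; case=> [||t0|[d [t0]]]; [lra|by rewrite lexx ler01|lra|].
  move: t0; case: d; rewrite /=; lra.
apply: connected_continuous_connected; first by apply/connected_intervalP;
  exact: interval_is_interval.
apply: continuous_subspaceT => t; apply: continuous_comp;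
  last exact: circle_point_continuous.
by apply: cvgD; [exact: cvg_cst|exact: cvg_id].
Qed.

(** A line through [q] meets the circle in at most one other point. *)
Lemma chord_nonzero (q a b : R * R) : unit_circle q -> unit_circle a ->
  unit_circle b ->
  a <> q -> b <> q -> a <> b ->
  (a.1 - q.1) * (b.2 - q.2) - (a.2 - q.2) * (b.1 - q.1) != 0.
Proof.
case: q a b => q1 q2 [a1 a2] [b1 b2]; rewrite /unit_circle /= => uq ua ub aq bq ab.
apply/eqP => cross.
pose A1 := a1 - q1; pose A2 := a2 - q2; pose B1 := b1 - q1; pose B2 := b2 - q2.
have cAB : A1 * B2 = A2 * B1 by rewrite /A1 /A2 /B1 /B2; lra.
have eA : A1 ^+ 2 + A2 ^+ 2 = - 2 * (q1 * A1 + q2 * A2).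
  by rewrite /A1 /A2; move: uq ua; rewrite !expr2; lra.
have eB : B1 ^+ 2 + B2 ^+ 2 = - 2 * (q1 * B1 + q2 * B2).
  by rewrite /B1 /B2; move: uq ub; rewrite !expr2; lra.
(* If the vectors (a, b) and (c, d) are parallel and both join [q] to a point
   of the circle, then [c] is 0 or [a]. It is used for either coordinate. *)
have key (r1 r2 a b c d : R) : a * d = b * c ->
    a ^+ 2 + b ^+ 2 = - 2 * (r1 * a + r2 * b) ->
    c ^+ 2 + d ^+ 2 = - 2 * (r1 * c + r2 * d) ->
    (a ^+ 2 + b ^+ 2) * (c * (c - a)) = 0.
  move=> adbc eab ecd.
  have : a ^+ 2 * (c ^+ 2 + d ^+ 2 + 2 * (r1 * c + r2 * d)) = 0.
    by rewrite ecd; ring.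
  have -> : a ^+ 2 * (c ^+ 2 + d ^+ 2 + 2 * (r1 * c + r2 * d)) =
      a ^+ 2 * c ^+ 2 + (a * d) ^+ 2 + 2 * a * (r1 * c * a + r2 * (a * d)) by ring.
  rewrite adbc => <-.
  have -> : 2 * a * (r1 * c * a + r2 * (b * c)) =
      - (a * c) * (- 2 * (r1 * a + r2 * b)) by ring.
  by rewrite -eab; ring.
have E1 := key q1 q2 A1 A2 B1 B2 cAB eA eB.
have E2 : (A1 ^+ 2 + A2 ^+ 2) * (B2 * (B2 - A2)) = 0.
  rewrite addrC; apply: (key q2 q1 A2 A1 B2 B1) => //.
    by rewrite addrC eA [q2 * _ + _]addrC.
  by rewrite addrC eB [q2 * _ + _]addrC.
have A0 : A1 ^+ 2 + A2 ^+ 2 != 0.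
  rewrite paddr_eq0 ?sqr_ge0 // !sqrf_eq0 /A1 /A2 !subr_eq0.
  by apply/negP => /andP[/eqP E /eqP E']; apply: aq; rewrite E E'.
have B0 : ~ (B1 = 0 /\ B2 = 0).
  move=> [/eqP + /eqP]; rewrite /B1 /B2 !subr_eq0 => /eqP E /eqP E'.
  by apply: bq; rewrite E E'.
have BA : ~ (B1 = A1 /\ B2 = A2).
  by move=> [/addIr E /addIr E']; apply: ab; rewrite E E'.
have {E1} /orP[/eqP B10|/eqP B1A] : (B1 == 0) || (B1 - A1 == 0).
  by move/eqP: E1; rewrite mulf_eq0 (negbTE A0) /= mulf_eq0.
  have {E2} /orP[/eqP B20|/eqP B2A] : (B2 == 0) || (B2 - A2 == 0).
    by move/eqP: E2; rewrite mulf_eq0 (negbTE A0) /= mulf_eq0.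
  - exact: B0.
  - have /eqP := cAB; rewrite B10 mulr0 mulf_eq0 => /orP[] /eqP z.
      by apply: BA; split; [rewrite z|apply/eqP; rewrite -subr_eq0 B2A].
    exact: B0.
have {E2} /orP[/eqP B20|/eqP B2A] : (B2 == 0) || (B2 - A2 == 0).
  by move/eqP: E2; rewrite mulf_eq0 (negbTE A0) /= mulf_eq0.
- have /esym/eqP := cAB; rewrite B20 mulr0 mulf_eq0 => /orP[] /eqP z.
    by apply: BA; split; [apply/eqP; rewrite -subr_eq0 B1A|rewrite z].
  exact: B0.
- by apply: BA; split; apply/eqP; rewrite -subr_eq0 ?B1A ?B2A.
Qed.

Variable T : topologicalType.
Implicit Types C : set T.

Lemma circleD1_connected C p : is_circle R C -> connected (C `\ p).
Proof.
move=> [f [g fg]]; have [_ _ fC gC] := fg.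
have cI A : A `<=` unit_circle -> connected A -> connected (f @` A).
  exact: homeo_image fg.
have [Cp|nCp] := pselect (C p); last first.
  have -> : C `\ p = f @` unit_circle.
    apply/seteqP; split=> [x [/gC[ugx fgx] _]|_ [q /fC[Cfq _] <-]].
      by exists (g x).
    by split=> // fqp; apply: nCp; rewrite -fqp.
  by apply: cI => //; exact: unit_circle_connected.
have [_ fgp] := gC p Cp.
have -> : C `\ p = f @` (unit_circle `\ g p).
  apply/seteqP; split=> [x [/gC[ugx fgx] xp]|_ [q [/fC[Cfq gfq] qp] <-]].
    by exists (g x) => //; split=> //= gxp; apply: xp; rewrite -fgx gxp.
  by split=> //= fqp; apply: qp; rewrite -gfq fqp.
by apply: cI; [move=> q []|exact: unit_circleD1_connected].
Qed.

Lemma circle_three_points C : is_circle R C ->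
  exists x y z, [/\ C x, C y & C z] /\ [/\ x <> y, y <> z & x <> z].
Proof.
move=> [f [g [_ _ fC _]]].
have f_inj p q : unit_circle p -> unit_circle q -> f p = f q -> p = q.
  by move=> /fC[_ {2}<-] /fC[_ {2}<-] ->.
have u1 : unit_circle (1, 0) by rewrite /Defs.unit_circle /=; ring.
have u2 : unit_circle (0, 1) by rewrite /Defs.unit_circle /=; ring.
have u3 : unit_circle (-1, 0) by rewrite /Defs.unit_circle /=; ring.
exists (f (1, 0)), (f (0, 1)), (f (-1, 0)); split.
  by split; [have [] := fC _ u1|have [] := fC _ u2|have [] := fC _ u3].
by split=> [/(f_inj _ _ u1 u2)|/(f_inj _ _ u2 u3)|/(f_inj _ _ u1 u3)] [] *; lra.
Qed.

(** Suppose that [q] is missed. The line through [q] and [psi a] cuts the rest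
    of the unit circle into two arcs, and one of them contains the connected
    image of [C] minus [a]: the sign of [cross a x] does not depend on [x]. As
    [cross] is antisymmetric, three points of [C] contradict this. *)
Lemma circle_onto C (psi : T -> R * R) : is_circle R C -> continuous psi ->
  (forall x, C x -> unit_circle (psi x)) ->
  (forall x y, C x -> C y -> psi x = psi y -> x = y) ->
  psi @` C = unit_circle.
Proof.
move=> cC psic psiu psi_inj; apply/seteqP; split=> [_ [x /psiu ? <-]//|q uq].
apply: contrapT => nq.
have psiq x : C x -> psi x <> q by move=> Cx xq; apply: nq; exists x.
pose cross a x := ((psi a).1 - q.1) * ((psi x).2 - q.2) -
                  ((psi a).2 - q.2) * ((psi x).1 - q.1).
have crossN a x : cross x a = - cross a x by rewrite /cross; ring.
have cross0 a x : C a -> C x -> a <> x -> cross a x != 0.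
  move=> Ca Cx ax; apply: chord_nonzero => //; try exact: psiu; try exact: psiq.
  by move=> E; apply: ax; exact: psi_inj E.
have cross_cts a : continuous (cross a).
  move=> x; have p1 : (psi y).1 @[y --> x] --> (psi x).1.
    by apply: continuous_comp (psic x) _; exact: cvg_fst.
  have p2 : (psi y).2 @[y --> x] --> (psi x).2.
    by apply: continuous_comp (psic x) _; exact: cvg_snd.
  by apply: cvgB; apply: cvgM; try exact: cvg_cst; apply: cvgB => //; exact: cvg_cst.
have sign a x y : C a -> C x -> C y -> a <> x -> a <> y -> 0 < cross a x ->
  0 < cross a y.
  move=> Ca Cx Cy ax ay pos; rewrite ltNge le_eqVlt; apply/negP => /orP[/eqP E|neg].
    by have := cross0 a y Ca Cy ay; rewrite E eqxx.
  have /connected_intervalP itv : connected (cross a @` (C `\ a)).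
    apply: connected_continuous_connected; first exact: circleD1_connected.
    exact: continuous_subspaceT.
  have iy : (cross a @` (C `\ a)) (cross a y).
    by exists y => //; split=> // ya; apply: ay.
  have ix : (cross a @` (C `\ a)) (cross a x).
    by exists x => //; split=> // xa; apply: ax.
  have [|z [Cz za] E] := itv _ _ iy ix 0; first by rewrite (ltW neg) (ltW pos).
  by have := cross0 a z Ca Cz (nesym za); rewrite E eqxx.
have no_pos x y z : C x -> C y -> C z -> x <> y -> y <> z -> x <> z ->
    ~ 0 < cross x y.
  move=> Cx Cy Cz xy yz xz pos.
  have pos_xz := sign x y z Cx Cy Cz xy xz pos.
  have := cross0 _ _ Cy Cz yz; rewrite neq_lt => /orP[neg|pos_yz].
    have := sign z y x Cz Cy Cx (nesym yz) (nesym xz).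
    by rewrite (crossN y z) (crossN x z) !oppr_gt0 => /(_ neg); lra.
  have := sign y z x Cy Cz Cx yz (nesym xy) pos_yz.
  by rewrite (crossN x y); lra.
have [x [y [z [[Cx Cy Cz] [xy yz xz]]]]] := circle_three_points cC.
have := cross0 _ _ Cx Cy xy; rewrite neq_lt => /orP[neg|pos].
  by apply: (no_pos y x z) => //; [exact: nesym|rewrite crossN oppr_gt0].
by apply: (no_pos x y z).
Qed.

End Circles.

(** * Edges of graph expansions *)

Section Words.
Variable n : nat.

Notation S := (rabbit_system n).
Notation letter := (alphabet S).
Notation word := (seq letter).

(** The letter of the edge from [iota] to [m] ([d = false]) or from [m] to
    [tau] ([d = true]). *)
Definition side (d : bool) : letter :=
  inr (@Tagged (colors S) tt (fun c => edge (repl (r:=S) c)) (inl d)).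

Lemma eq_side c (f : edge (repl (r:=S) c)) d :
  (inr (@Tagged (colors S) c (fun c => edge (repl (r:=S) c)) f) == side d) = (f
    == inl d).
Proof. by case: c f => f; apply/eqP/eqP => [[]|->]. Qed.

Definition loop (c : letter) : bool := [forall d, c != side d].

Definition is_base (c : letter) : bool := if c is inl _ then true else false.

Definition valid_word (w : word) : Prop :=
  forall k, (k < size w)%N -> is_base (nth (side false) w k) = (k == 0)%N.

Fixpoint rev_end (d : bool) (w : word) : word :=
  if w is c :: w' then if c == side d then rev_end d w' else rev w' else [::].

(** The initial ([d = false]) or terminal ([d = true]) vertex of the edge
    named [w], where a vertex is named by the edge whose expansion creates it,
    and the base vertex by the empty word. The half [side d] of an edge keeps
    the end [d] of that edge; every other end of a new edge is the new
    vertex. *)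
Definition word_end (d : bool) (w : word) : word := rev_end d (rev w).

Lemma word_end_rcons d w c :
  word_end d (rcons w c) = if c == side d then word_end d w else w.
Proof. by rewrite /word_end rev_rcons /= revK. Qed.

Lemma side_inj : injective side.
Proof. by move=> [] [] //= /eqP. Qed.

Lemma valid_rcons w c :
  valid_word (rcons w c) <-> valid_word w /\ is_base c = (size w == 0)%N.
Proof.
split=> [vw|[vw cw] k]; last first.
  rewrite size_rcons ltnS leq_eqVlt nth_rcons => /predU1P[->|kw].
    by rewrite ltnn eqxx.
  by rewrite kw; exact: vw.
split=> [k kw|]; last first.
  by have := vw (size w); rewrite size_rcons nth_rcons ltnn eqxx; exact.
by have := vw k; rewrite size_rcons nth_rcons kw; apply; exact: ltnW.
Qed.

(** [V] names the vertices of [G]. The two prefix conditions say that no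
    vertex has been created inside an edge of [G] yet, and that no edge of [G]
    lies inside another one; they are what keeps the names distinct when an
    edge is expanded. *)
Definition naming (G : named_graph S) (V : vertex G -> word) : Prop :=
  [/\ injective V,
      forall e : edge G, V (init e) = word_end false (name e) /\
                         V (term e) = word_end true (name e),
      forall (e : edge G) v, ~~ prefix (name e) (V v),
      forall e f : edge G, prefix (name e) (name f) -> e = f &
      forall e : edge G, valid_word (name e) /\ name e <> [::]].

Lemma not_prefix_rcons (w : word) c : ~~ prefix (rcons w c) w.
Proof.
apply/negP => /prefixP[t] /(congr1 size).
by rewrite size_cat size_rcons; lia.
Qed.

Lemma prefix_rconsW (w : word) c w' : prefix (rcons w c) w' -> prefix w w'.
Proof. by apply: prefix_trans; exact: prefix_rcons. Qed.

Lemma prefix_size_eq (w w' : word) : prefix w w' -> size w = size w' -> w = w'.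
Proof.
move=> /prefixP[t ->]; rewrite size_cat => /eqP.
by rewrite -{1}(addn0 (size w)) eqn_add2l eq_sym size_eq0 => /eqP->; rewrite cats0.
Qed.

Lemma prefix_rconsE (w w' : word) c :
  prefix w (rcons w' c) = (w == rcons w' c) || prefix w w'.
Proof.
apply/idP/orP => [/prefixP[t]|[/eqP->|]]; last 2 first.
- exact: prefix_refl.
- by move=> /prefix_trans; apply; exact: prefix_rcons.
case/lastP: t => [|t d]; first by rewrite cats0 => ->; left.
by rewrite -rcons_cat => /rcons_inj[-> _]; right; exact: prefix_prefix.
Qed.

Lemma graph_expansion_naming (G : named_graph S) :
  graph_expansion G -> exists V, @naming G V.
Proof.
elim=> {G} [|G e _ [V [Vinj Vends Vpre npre nval]]].
  exists (fun=> [::]); split=> //=.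
  - by move=> [] [].
  - by move=> e f; rewrite /= andbT => /eqP[].
  - by move=> e; split=> // -[|k].
pose V' (v : vertex (Defs.expand e)) :=
  match v with inl v => V v | inr _ => name e end.
have attachE (v : vertex (repl (color e))) :
    V' (attach v) = match v with
      | Some false => word_end false (name e)
      | None => name e
      | Some true => word_end true (name e) end.
  have [Vi Vt] := Vends e.
  rewrite /attach; case: insubP => [u|]; rewrite /interior_vertex /=.
    by move: v => [[]|].
  by move: v => [[]|].
exists V'; split=> [||f v|f g|f].
- move=> [v|v] [v'|v'] //= E.
  + by congr inl; exact: Vinj.
  + by have := Vpre e v; rewrite E prefix_refl.
  + by have := Vpre e v'; rewrite -E prefix_refl.
  + congr inr; apply/val_inj; move: v v' {E} => [v vi] [v' vi'] /=.
    by move: v v' vi vi' => [[]|] [[]|].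
- move=> [f|f]; first exact: Vends.
  rewrite [init _]/= [term _]/= !attachE.
  have -> : name (inr f : edge (Defs.expand e)) =
      rcons (name e) (inr (Tagged (fun d => edge (repl d)) f)) by [].
  by rewrite !word_end_rcons !eq_side; move: f => [[]|i].
- case: f => [[f fe]|f]; case: v => [v|v] //=.
  + by apply/negP => /npre fE; rewrite fE eqxx in fe.
  + by apply: contra (Vpre e v) => /prefix_rconsW.
  + exact: not_prefix_rcons.
- case: f => [[f fe]|f]; case: g => [[g ge]|g] //=.
  + by move=> /npre fg; congr inl; apply/val_inj.
  + rewrite prefix_rconsE => /predU1P[fE|/npre E]; last by case/eqP: (fe).
    have /npre E : prefix (name e) (name f) by rewrite fE prefix_rcons.
    by case/eqP: (fe).
  + by move=> /prefix_rconsW/npre E; case/eqP: (ge).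
  + move=> /prefix_size_eq; rewrite !size_rcons => /(_ erefl)/rcons_inj[].
    by move=> /eqP; rewrite /eq_op/= => /eqP/= ->.
- case: f => [[f fe]|f] /=; first exact: nval.
  have [ev e0] := nval e.
  split; last by case: (name e).
  by rewrite valid_rcons; split=> //; case: (name e) e0.
Qed.

Lemma expand_edge_last (G : named_graph S) (e : edge G) c :
  is_base c = false ->
  exists f : edge (Defs.expand e), name f = rcons (name e) c.
Proof.
by case: c => // -[[] f] _; exists (inr f) => /=; case: (color e).
Qed.

Lemma valid_word_cat (u v : word) : valid_word (u ++ v) -> valid_word u.
Proof.
elim/last_ind: v => [|v c IH]; first by rewrite cats0.
by rewrite -rcons_cat valid_rcons => -[/IH].
Qed.

(** By induction on the length, some expansion features the two parent edges;
    it remains to expand these, one after the other if they differ. *)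
Lemma graph_expansion_pair (u v : word) : valid_word u -> valid_word v ->
  size u = size v -> u != [::] ->
  exists2 G, graph_expansion G &
    exists e f : edge G, name e = u /\ name f = v.
Proof.
elim/last_ind: u v => // u c IH v; case/lastP: v => [|v d];
  first by rewrite size_rcons.
rewrite !valid_rcons !size_rcons => -[uv cu] [vv dv] [uvs] _.
have [u0|u0] := eqVneq u [::].
  move: cu dv uvs; rewrite u0 /=; case: v {vv} => //; case: c => // i _;
    case: d => // j _ _.
  exists (base_named S); first exact: expansion_base.
  by exists i, j.
have s0 : (size u == 0)%N = false by case: (u) u0.
have [G Gx [e [f [ue vf]]]] := IH v uv vv uvs u0.
rewrite -uvs s0 in dv; rewrite s0 in cu.
have [ef|fe] := eqVneq f e.
  exists (Defs.expand e); first exact: expansion_step.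
  have [e' e'E] := expand_edge_last e cu; have [f' f'E] := expand_edge_last e dv.
  by exists e', f'; rewrite e'E f'E ue -vf ef ue.
have [e' e'E] := expand_edge_last e cu.
(* The second parent is still an edge after the expansion of the first one. *)
pose f0 : edge (Defs.expand e) := inl (exist _ f fe).
have e'f0 : e' != f0.
  have [V [_ _ _ npre _]] := graph_expansion_naming (expansion_step e Gx).
  apply/eqP => ef0; move: e'E; rewrite ef0 /= vf ue => /(congr1 size).
  by rewrite size_rcons uvs; lia.
exists (Defs.expand f0); first by do 2 apply: expansion_step.
have [f' f'E] := expand_edge_last f0 dv.
exists (inl (exist _ e' e'f0)), f'; split.
  by rewrite -[LHS]/(name e') e'E ue.
by rewrite f'E -[name f0]/(name f) vf.
Qed.

Lemma edge_wordE (w : word) : edge_word w <-> valid_word w /\ w <> [::].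
Proof.
split=> [[G [/graph_expansion_naming[V [_ _ _ _ nval]] [e <-]]]|[wv w0]].
  exact: nval.
have [|G Gx [e [f [we _]]]] := graph_expansion_pair wv wv erefl.
  exact/eqP.
by exists G; split=> //; exists e.
Qed.

Definition share_end (u v : word) : Prop :=
  exists p, p \in [:: word_end false u; word_end true u] /\
            p \in [:: word_end false v; word_end true v].

(** The vertices of an expansion are determined by their names, so that
    incidence of two edges can be read on the names of these edges. *)
Lemma incident_nameE (G : named_graph S) (e f : edge G) : graph_expansion G ->
  incident e f <-> share_end (name e) (name f).
Proof.
move=> /graph_expansion_naming[V [Vinj Vends _ _ _]].
rewrite /share_end; have [<- <-] := Vends e; have [<- <-] := Vends f.
split=> [[v]|[p]]; rewrite !inE.
  by move=> [/orP vE /orP vF]; exists (V v); rewrite !inE;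
    split; [case: vE|case: vF] => /eqP ->; rewrite eqxx ?orbT.
move=> [pe pf].
have [v vp] : exists v, p = V v.
  by case/orP: pe => /eqP->; [exists (init e)|exists (term e)].
by exists v; move: pe pf; rewrite vp !inE !(inj_eq Vinj).
Qed.

(** By [incident_nameE] all the expansions that feature both prefixes agree on
    incidence, and by [graph_expansion_pair] there is one. *)
Lemma gluingE (x y : @symbol_space S) : gluing x y <->
  exists N, forall k, (N <= k)%N ->
    share_end (prefix_word (val x) k) (prefix_word (val y) k).
Proof.
split=> -[N xy]; exists N.+1 => k Nk; last first.
  by move=> G Gx e f eE fE; rewrite (incident_nameE _ _ Gx) eE fE;
    exact: xy (ltnW Nk).
have k0 : (0 < k)%N by lia.
have /edge_wordE[vx x0] := set_valP x k k0.
have /edge_wordE[vy _] := set_valP y k k0.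
have [||G Gx [e [f [eE fE]]]] := graph_expansion_pair vx vy.
- by rewrite !size_mkseq.
- exact/eqP.
by have := xy k (ltnW Nk) G Gx e f eE fE; rewrite (incident_nameE _ _ Gx) eE fE.
Qed.

End Words.

(** * Binary position along an edge *)

Section Theta.
Variables (R : realType) (n : nat).

Notation S := (rabbit_system n).
Notation letter := (alphabet S).
Notation word := (seq letter).
Notation stream := (infinite_words S).
Notation side := (@side n).

Definition skip (k : nat) (x : stream) : stream := fun j => x (k + j)%N.

Lemma skipD j k x : skip j (skip k x) = skip (k + j) x.
Proof. by apply/funext => i; rewrite /skip addnA. Qed.

Lemma skip0 x : skip 0 x = x.
Proof. by apply/funext. Qed.

Definition agree (k : nat) (x y : stream) : Prop := forall j, (j < k)%N -> x j = y j.

Lemma letterP (c : letter) : [\/ c = side false, c = side true | loop c].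
Proof.
have [->|c0] := eqVneq c (side false); first by constructor 1.
have [->|c1] := eqVneq c (side true); first by constructor 2.
by constructor 3; apply/forallP => -[].
Qed.

Lemma loop_side d : loop (side d) = false.
Proof. by apply/negbTE/forallPn; exists d; rewrite negbK. Qed.

Lemma loop_neq_side c d : loop c -> c != side d.
Proof. by move=> /forallP. Qed.

(** One step in reading an address as a binary expansion: a half of the edge
    adds a digit, and a loop stops the reading at the midpoint. *)
Definition halve (c : letter) (t : R) : R :=
  if c == side false then t / 2
  else if c == side true then (1 + t) / 2 else 1 / 2.

Lemma halve_side d t : halve (side d) t = (d%:R + t) / 2.
Proof.
rewrite /halve !(inj_eq (@side_inj n)).
by case: d => //=; rewrite add0r.
Qed.

Lemma halve_loop c t : loop c -> halve c t = 1 / 2.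
Proof. by move=> cl; rewrite /halve !(negbTE (loop_neq_side _ cl)). Qed.

Lemma halve_homo c : {homo halve c : s t / s <= t}.
Proof.
move=> s t st; case: (letterP c) => [->|->|cl]; rewrite ?halve_side /=; try lra.
by rewrite !halve_loop.
Qed.

Lemma halve01 c t : 0 <= t <= 1 -> 0 <= halve c t <= 1.
Proof.
by case: (letterP c) => [->|->|cl]; rewrite ?halve_side ?halve_loop //=; lra.
Qed.

Lemma halve_dist c s t : `|halve c s - halve c t| <= `|s - t| / 2.
Proof.
case: (letterP c) => [->|->|cl]; rewrite ?halve_side ?halve_loop //;
  last by rewrite subrr normr0 divr_ge0.
all: rewrite -mulrBl normrM [`|2^-1|]ger0_norm ?invr_ge0//.
all: by rewrite opprD addrACA subrr add0r.
Qed.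

Fixpoint approx (k : nat) (x : stream) : R :=
  if k is k'.+1 then halve (x 0%N) (approx k' (skip 1 x)) else 0.

Lemma approx01 k x : 0 <= approx k x <= 1.
Proof. by elim: k x => [|k IH] x /=; [rewrite lexx ler01|exact: halve01]. Qed.

Lemma approx_nondecreasing x : nondecreasing_seq (approx ^~ x).
Proof.
apply/nondecreasing_seqP => k; elim: k x => [|k IH] x; last exact: halve_homo.
by have /andP[] := approx01 1 x.
Qed.

Lemma approx_cvg x : cvgn (approx ^~ x).
Proof.
apply: nondecreasing_is_cvgn; first exact: approx_nondecreasing.
by exists 1 => _ [k _ <-]; have /andP[] := approx01 k x.
Qed.

(** The position in [0, 1] along an edge of the point at which the address [x]
    leaves that edge: the halves are binary digits, and the first loop, which
    is attached at a dyadic point, ends the expansion. *)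
Definition theta (x : stream) : R := limn (approx ^~ x).

Lemma theta01 x : 0 <= theta x <= 1.
Proof.
apply/andP; split.
  apply: limr_ge; first exact: approx_cvg.
  by near=> k; have /andP[] := approx01 k x.
apply: limr_le; first exact: approx_cvg.
by near=> k; have /andP[] := approx01 k x.
Unshelve. all: by end_near. Qed.

Lemma halve_continuous c : continuous (halve c).
Proof.
have hs d : continuous (halve (side d)).
  have -> : halve (side d) = fun t => (d%:R + t) / 2.
    by apply/funext => t; rewrite halve_side.
  by move=> t; apply: cvgM; [apply: cvgD; [exact: cvg_cst|exact: cvg_id]|exact:
    cvg_cst].
case: (letterP c) => [->|->|cl]; [exact: hs|exact: hs|].
have -> : halve c = fun=> 1 / 2 by apply/funext => t; rewrite halve_loop.
exact: cst_continuous.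
Qed.

Lemma thetaE x : theta x = halve (x 0%N) (theta (skip 1 x)).
Proof.
apply/cvg_lim => //; rewrite -(cvg_shiftn 1).
have -> : (fun k => approx (k + 1) x) =
    halve (x 0%N) \o (approx ^~ (skip 1 x)).
  by apply/funext => k; rewrite addn1.
apply: continuous_cvg; [exact: halve_continuous|exact: approx_cvg].
Qed.

Lemma theta_agree k x y : agree k x y -> `|theta x - theta y| <= 2^-1 ^+ k.
Proof.
elim: k x y => [|k IH] x y xy.
  by have := theta01 x; have := theta01 y; rewrite expr0 ler_norml; lra.
rewrite thetaE (thetaE y) xy // exprSr; apply: le_trans (halve_dist _ _ _) _.
by rewrite ler_pM2r ?invr_gt0// IH // => j jk; exact: xy.
Qed.

Lemma eq_theta_skip k x y : agree k x y ->
  theta (skip k x) = theta (skip k y) -> theta x = theta y.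
Proof.
elim: k x y => [|k IH] x y xy; first by rewrite !skip0.
rewrite -!(skipD k 1) => xyk; rewrite thetaE (thetaE y) xy //.
by congr halve; apply: IH => // j jk; exact: xy.
Qed.

Lemma theta_skip_sides k x y : agree k x y ->
  (forall j, (j < k)%N -> ~~ loop (x j)) ->
  theta y - theta x = (theta (skip k y) - theta (skip k x)) * 2^-1 ^+ k.
Proof.
elim: k x y => [|k IH] x y xy xs; first by rewrite !skip0 expr0 mulr1.
rewrite thetaE (thetaE x) -!(skipD k 1) exprSr mulrA -IH; last 2 first.
- by move=> j jk; exact: xy.
- by move=> j jk; exact: xs.
rewrite xy //; have := xs 0%N isT; rewrite xy //.
case: (letterP (y 0%N)) => [->|->|->//] _; rewrite !halve_side /=; lra.
Qed.

Lemma theta_loop x : loop (x 0%N) -> theta x = 1 / 2.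
Proof. by move=> xl; rewrite thetaE halve_loop. Qed.

Lemma theta_eq_bool (d : bool) x : theta x = d%:R <-> forall k, x k = side d.
Proof.
split=> [xd k|xd]; last first.
  have sx : skip 1 x = x by apply/funext => k; rewrite /skip !xd.
  by have := thetaE x; rewrite sx xd halve_side; case: (d) => /=; lra.
have head y : theta y = d%:R -> y 0%N = side d /\ theta (skip 1 y) = d%:R.
  have := theta01 (skip 1 y); rewrite (thetaE y).
  by case: (letterP (y 0%N)) => [->|->|cl];
    rewrite ?halve_side ?(halve_loop _ cl) /=; case: (d) => /= ? ?;
    first [by exfalso; lra|by split=> //; lra].
have xkd : theta (skip k x) = d%:R.
  elim: k => [|k /head[_]]; first by rewrite skip0.
  by rewrite skipD addn1.
by have [] := head _ xkd; rewrite /skip addn0.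
Qed.

Lemma theta_half x : theta x = 1 / 2 <->
  loop (x 0%N) \/ exists d, x 0%N = side (~~ d) /\ forall k, x k.+1 = side d.
Proof.
have half d : x 0%N = side d -> theta (skip 1 x) = (~~ d)%:R <-> theta x = 1 / 2.
  by move=> x0; rewrite (thetaE x) x0 halve_side; case: d {x0} => /=; split; lra.
split=> [xh|[/theta_loop//|[d [x0 xd]]]]; last first.
  by apply/(half _ x0); rewrite negbK; apply/theta_eq_bool.
have side_half d : x 0%N = side d ->
    exists d, x 0%N = side (~~ d) /\ forall k, x k.+1 = side d.
  move=> x0; exists (~~ d); rewrite negbK; split=> //.
  by apply/theta_eq_bool; apply/(half _ x0).
case: (letterP (x 0%N)) => [/side_half|/side_half|]; [by right|by right|by left].
Qed.

(** [x] is a binary expansion of [t]: the difference between the position of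
    the rest of [x] and the rest of [t] is halved by each digit, hence is zero
    at the start. *)
Lemma theta_onto t : 0 <= t <= 1 ->
  exists2 x : stream, (forall k, ~~ loop (x k)) & theta x = t.
Proof.
move=> t01.
(* The doubling map, whose orbit of [t] yields the digits. *)
pose next (s : R) : R := if s <= 1 / 2 then 2 * s else 2 * s - 1.
pose x : stream := fun k => side (~~ (iter k next t <= 1 / 2)).
exists x; first by move=> k; rewrite loop_side.
have s01 k : 0 <= iter k next t <= 1.
  by elim: k => // k; rewrite iterS /next; case: ifP; lra.
have dist k : `|theta (skip k x) - iter k next t| <=
              `|theta (skip k.+1 x) - iter k.+1 next t| / 2.
  have -> : theta (skip k x) = halve (x k) (theta (skip k.+1 x)).
    by rewrite thetaE skipD addn1 {1}/skip addn0.
  have -> : x k = side (~~ (iter k next t <= 1 / 2)) by [].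
  rewrite halve_side iterS; move: (theta _) (iter k next t) => a b.
  have -> : `|a - next b| / 2 = `|(a - next b) / 2|.
    by rewrite normrM [`|2^-1|]ger0_norm ?invr_ge0.
  rewrite /next.
  by rewrite le_eqVlt; apply/orP; left; apply/eqP; case: ifP => /= _;
    congr `| _ |; field.
have dist2 k : `|theta x - t| <= 2^-1 ^+ k.
  have : `|theta x - t| <= `|theta (skip k x) - iter k next t| * 2^-1 ^+ k.
    elim: k => [|k IH]; first by rewrite skip0 expr0 mulr1.
    apply: le_trans IH _; rewrite exprS mulrA.
    by apply: ler_wpM2r (dist k); rewrite exprn_ge0 ?invr_ge0.
  move=> /le_trans; apply; rewrite ler_piMl ?exprn_ge0 ?invr_ge0 //.
  by have := s01 k; have := theta01 (skip k x); rewrite ler_norml; lra.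
apply/eqP; rewrite -subr_eq0 -normr_le0.
have cv : (fun k => 2^-1 ^+ k : R) @ \oo --> (0 : R).
  by apply: cvg_expr; rewrite ger0_norm ?invr_ge0 // invf_lt1 // ltr1n.
rewrite -(cvg_lim _ cv) //; apply: limr_ge; first by apply/cvg_ex; exists 0.
by near=> k; exact: dist2.
Unshelve. all: by end_near. Qed.

End Theta.

(** * Coordinates of addresses and gluing *)

Section Gluing.
Variables (R : realType) (n : nat).

Notation S := (rabbit_system n).
Notation letter := (alphabet S).
Notation word := (seq letter).
Notation stream := (infinite_words S).
Notation side := (@side n).
Notation theta := (@theta R n).
Notation circle_point := (@circle_point R).

Definition loop_word (w : word) : bool := loop (last (side false) w).

Definition begins (w : word) (x : stream) : bool := prefix_word x (size w) == w.

(** The retraction onto the circle of a loop word [w], in R/Z: addresses that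
    do not begin with [w] go to the root of the circle. The value at words
    that are not loop words is arbitrary. *)
Definition angle (w : word) (x : stream) : R :=
  if loop_word w && begins w x then theta (skip (size w) x) else 0.

Definition stream_coord (w : word) (x : stream) : R * R := circle_point (angle w x).

Definition valid (x : stream) : Prop := forall k, is_base (x k) = (k == 0)%N.

(** [x] is an address of the vertex [u]: it selects below the edge [u] an edge
    whose end [d] is that vertex, and then keeps to this end for ever. *)
Definition tail (u : word) (d : bool) (x : stream) : Prop :=
  [/\ begins u x, x (size u) != side d & forall k, (size u < k)%N -> x k = side d].

Definition represents (u : word) (x : stream) : Prop := exists d, tail u d x.

Lemma loop_word_rcons w c : loop_word (rcons w c) = loop c.
Proof. by rewrite /loop_word last_rcons. Qed.

Lemma beginsP w x : reflect (forall k, (k < size w)%N -> x k = nth (side false) w k)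
  (begins w x).
Proof.
apply: (iffP eqP) => [<- k|wx]; first by rewrite size_mkseq => kw; rewrite nth_mkseq.
apply: (@eq_from_nth _ (side false)); rewrite size_mkseq // => k kw.
by rewrite nth_mkseq // wx.
Qed.

Lemma begins_prefix x k : begins (prefix_word x k) x.
Proof. by rewrite /begins size_mkseq. Qed.

Lemma begins_rcons w c x : begins (rcons w c) x = begins w x && (x (size w) == c).
Proof.
rewrite /begins size_rcons /prefix_word /mkseq -addn1 iotaD map_cat /= cats1.
by rewrite eqseq_rcons.
Qed.

Lemma prefix_wordS (x : stream) k : prefix_word x k.+1 = rcons (prefix_word x
  k) (x k).
Proof. by rewrite /prefix_word /mkseq -addn1 iotaD map_cat cats1. Qed.

Lemma begins_agree w x y : begins w x -> begins w y -> agree (size w) x y.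
Proof. by move=> /beginsP wx /beginsP wy j jw; rewrite wx // wy. Qed.

Lemma agree_begins w x y k : agree k x y -> (size w <= k)%N -> begins w x ->
  begins w y.
Proof.
move=> xy wk /beginsP wx; apply/beginsP => j jw.
by rewrite -wx // xy //; exact: leq_trans wk.
Qed.

Lemma agree_sym k (x y : stream) : agree k x y -> agree k y x.
Proof. by move=> xy j jk; rewrite xy. Qed.

Lemma agree_prefix k (x y : stream) : agree k x y <-> begins (prefix_word x k) y.
Proof.
split=> [xy|/beginsP xy j jk].
  by apply: agree_begins xy _ (begins_prefix _ _); rewrite size_mkseq.
by rewrite xy ?size_mkseq // nth_mkseq.
Qed.

Lemma loop_base (c : letter) : is_base c -> loop c.
Proof. by move=> cb; apply/forallP => d; apply: contraL cb => /eqP->. Qed.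

Lemma tail_word_end u d x k : tail u d x -> (size u < k)%N ->
  word_end d (prefix_word x k) = u.
Proof.
move=> [/eqP ux xu xd]; elim: k => // k IH; rewrite ltnS leq_eqVlt prefix_wordS.
case/predU1P => [<-|uk]; rewrite word_end_rcons.
  by rewrite (negbTE xu) ux.
by rewrite xd // eqxx IH.
Qed.

(** The address of the end [d] of the edge [w]. *)
Definition extend (w : word) (d : bool) : stream := fun k => nth (side d) w k.

Lemma begins_extend w d : begins w (extend w d).
Proof. by apply/beginsP => k kw; exact: set_nth_default. Qed.

Lemma valid_prefix x k : valid x -> valid_word (prefix_word x k).
Proof. by move=> vx j; rewrite size_mkseq => jk; rewrite nth_mkseq. Qed.

Lemma valid_extend w d : valid_word w -> w <> [::] -> valid (extend w d).
Proof.
move=> vw w0 k; rewrite /extend; have [kw|wk] := ltnP k (size w).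
  by rewrite (set_nth_default (side false)) // vw.
by rewrite nth_default //; case: k wk => //; case: (w) w0.
Qed.

Lemma extend_represents w d : valid_word w -> w <> [::] ->
  tail (word_end d w) d (extend w d).
Proof.
elim/last_ind: w => // w c IH /valid_rcons[vw cw] _; rewrite word_end_rcons.
have [cd|cd] := eqVneq c (side d).
  have w0 : w <> [::] by move=> w0; move: cw; rewrite cd w0.
  have -> : extend (rcons w c) d = extend w d.
    apply/funext => k; rewrite /extend nth_rcons; case: ltnP => // wk.
    by rewrite cd if_same nth_default.
  exact: IH.
have := begins_extend (rcons w c) d; rewrite begins_rcons => /andP[wx /eqP xc].
split=> //; first by rewrite xc.
by move=> k wk; rewrite /extend nth_default // size_rcons.
Qed.

Lemma theta_tail u d x : tail u d x -> theta (skip (size u) x) = 1 / 2.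
Proof.
move=> [_ xu xd]; apply/theta_half.
have sE k : skip (size u) x k.+1 = side d by rewrite /skip xd // addnS ltnS leq_addr.
have {xu} : skip (size u) x 0%N != side d by rewrite /skip addn0.
case: (letterP (skip (size u) x 0%N)) => [E|E|]; last by left.
all: by rewrite E => ed; right; exists d; case: d ed {xd} sE => //; rewrite eqxx.
Qed.

(** If [x] begins with [w], the loop that ends [w] can only be the letter of
    [x] just after [u]. *)
Lemma angle_tail u d x w : tail u d x -> (size u < size w)%N ->
  angle w x = 0 \/ angle w x = 1.
Proof.
move=> [_ _ xd] uw; rewrite /angle; case: ifP => [/andP[lw wx]|_]; last by left.
have E : size w = (size u).+1.
  apply/eqP; rewrite eqn_leq uw andbT leqNgt; apply/negP => uw1.
  case/lastP: w uw lw wx uw1 => // w c _; rewrite loop_word_rcons begins_rcons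
    size_rcons ltnS.
  by move=> cl /andP[_ /eqP xc] uw; rewrite -xc xd // loop_side in cl.
have : theta (skip (size w) x) = d%:R.
  by apply/theta_eq_bool => k; rewrite /skip xd // E; lia.
by case: (d) => ->; [right|left].
Qed.

Lemma stream_coord_end w x : angle w x = 0 \/ angle w x = 1 ->
  stream_coord w x = circle_point 0.
Proof. by rewrite /stream_coord => -[->//|->]; exact: (circle_point_bool R true). Qed.

(** If [w] is not longer than [u], the two addresses agree on the circle of
    [w] up to the edge [u], whose midpoint is the vertex [u]. Otherwise both
    are sent to the root. *)
Lemma stream_coord_represents u x y w : represents u x -> represents u y ->
  stream_coord w x = stream_coord w y.
Proof.
move=> [d xd] [e ye]; have [uw|wu] := ltnP (size u) (size w).
  by rewrite !stream_coord_end //; [exact: angle_tail ye uw|exact: angle_tail xd uw].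
rewrite /stream_coord /angle.
have [ux _ _] := xd; have [uy _ _] := ye.
have xy := begins_agree ux uy.
have -> : begins w x = begins w y.
  by apply/idP/idP; apply: (agree_begins _ wu) => //; exact: agree_sym.
case: ifP => // _; congr circle_point.
apply: (@eq_theta_skip _ _ (size u - size w)%N).
  by move=> j jk; rewrite /skip xy //; lia.
by rewrite !skipD subnKC // (theta_tail xd) (theta_tail ye).
Qed.

Lemma last_loop x k : valid x -> (0 < k)%N -> exists j,
  [/\ (j < k)%N, loop (x j) & forall i, (j < i < k)%N -> ~~ loop (x i)].
Proof.
move=> vx; elim: k => // -[_ _|k /(_ isT)[j [jk xj xi]] _].
  by exists 0%N; split=> //; [apply: loop_base; rewrite vx|move=> i; case: i].
case: (boolP (loop (x k.+1))) => xk.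
  by exists k.+1; split=> // i; rewrite ltnS; lia.
exists j; split=> // [|i /andP[ji]]; first exact: ltnW.
by rewrite ltnS leq_eqVlt => /predU1P[->//|ik]; apply: xi; rewrite ji.
Qed.

Lemma represents_half x k :
  (loop (x k) -> exists d, forall j, (k < j)%N -> x j = side d) ->
  theta (skip k x) = 1 / 2 -> represents (prefix_word x k) x.
Proof.
move=> xl; rewrite /represents /tail begins_prefix size_mkseq => /theta_half[|[d]].
  rewrite /skip addn0 => xk; have [d xd] := xl xk.
  by exists d; split=> //; exact: loop_neq_side.
rewrite /skip addn0 => -[xk xd]; exists d; split=> //.
  by rewrite xk (inj_eq (@side_inj n)); case: (d).
by case=> // j kj; rewrite -(xd (j - k)%N) addnS subnKC.
Qed.

Lemma angle_loop x k : loop (x k) ->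
  angle (prefix_word x k.+1) x = theta (skip k.+1 x).
Proof.
by move=> xk; rewrite /angle begins_prefix size_mkseq prefix_wordS loop_word_rcons xk.
Qed.

Lemma loop_tail x k : loop (x k) ->
  stream_coord (prefix_word x k.+1) x = circle_point 0 ->
  exists d, forall j, (k < j)%N -> x j = side d.
Proof.
move=> xk; rewrite /stream_coord angle_loop // => /circle_point_inj E.
have [d /theta_eq_bool xd] : exists d : bool, theta (skip k.+1 x) = d%:R.
  have [||->|[d [-> _]]] := E; [exact: theta01|by rewrite lexx ler01|..].
  - by exists false.
  - by exists d.
by exists d => j kj; rewrite -(xd (j - k.+1)%N) /skip subnKC.
Qed.

Lemma stream_coord_not_begins w x : ~~ begins w x ->
  stream_coord w x = circle_point 0.
Proof. by move=> wx; rewrite /stream_coord /angle (negbTE wx) andbF. Qed.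

(** This turns out to be the gluing relation. *)
Definition glued (x y : stream) : Prop :=
  x = y \/ exists2 u, represents u x & represents u y.

Lemma glued_sym x y : glued x y -> glued y x.
Proof. by move=> [->|[u ux uy]]; [left|right; exists u]. Qed.

Lemma first_difference (x y : stream) : x <> y -> exists2 k, agree k x y & x k != y k.
Proof.
move=> xy; have ex : exists k, x k != y k.
  apply: contrapT => nex; apply: xy; apply/funext => k; apply/eqP.
  by apply: contrapT => /negP xyk; apply: nex; exists k.
case: (ex_minnP ex) => k xyk kmin; exists k => // j jk; apply/eqP.
by apply: contraLR jk => /kmin; rewrite -leqNgt.
Qed.

(** Since [y] is not below the loop [x k], the circle of this loop sees [y] at
    its root, hence [x] too. *)
Lemma glued_loops x y k : agree k x y -> x k != y k ->
  (forall w, stream_coord w x = stream_coord w y) -> loop (x k) ->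
  exists d, forall j, (k < j)%N -> x j = side d.
Proof.
move=> xy xyk E xk; apply: loop_tail => //; rewrite E stream_coord_not_begins //.
rewrite prefix_wordS begins_rcons size_mkseq negb_and; apply/orP; right.
by rewrite eq_sym.
Qed.

(** If [x k] is a loop, [x] is an address of the root of this loop. *)
Definition const_after_loop (x : stream) k : Prop :=
  loop (x k) -> exists d, forall j, (k < j)%N -> x j = side d.

(** The loop [j] is the last one that [x] and [y] have in common. On its
    circle they occupy the same position, though they lie on both sides of the
    midpoint of the edge at depth [k]. Either both are at this midpoint, or
    they are the two ends of the loop [j], which are its root. *)
Lemma glued_on_circle x y j k : agree k x y -> (j < k)%N -> loop (x j) ->
  (forall i, (j < i < k)%N -> ~~ loop (x i)) ->
  const_after_loop x k -> const_after_loop y k ->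
  theta (skip k x) <= 1 / 2 <= theta (skip k y) ->
  stream_coord (prefix_word x j.+1) x = stream_coord (prefix_word x j.+1) y ->
    glued x y.
Proof.
move=> xy jk xj xi xk yk half.
have lx := angle_loop xj.
have pre : prefix_word x j.+1 = prefix_word y j.+1.
  apply: (@eq_from_nth _ (side false)); rewrite !size_mkseq // => i ij.
  by rewrite !nth_mkseq // xy //; exact: leq_trans jk.
have yj : loop (y j) by rewrite -xy.
rewrite /stream_coord lx pre (angle_loop yj).
have ag : agree (k - j.+1)%N (skip j.+1 x) (skip j.+1 y).
  by move=> i ik; rewrite /skip xy //; lia.
have /theta_skip_sides : forall i, (i < k - j.+1)%N -> ~~ loop (skip j.+1 x i).
  by move=> i ik; apply: xi; lia.
move=> /(_ R _ ag); rewrite !skipD subnKC //.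
have xk1 : prefix_word x k = prefix_word y k.
  by apply/esym/eqP; have /agree_prefix := xy; rewrite /begins size_mkseq.
move=> D /circle_point_inj[||xyE|[d [xd yd]]]; try exact: theta01.
  have : theta (skip k y) - theta (skip k x) = 0.
    apply/eqP; have /eqP := D; rewrite xyE subrr eq_sym mulf_eq0.
    by rewrite (gt_eqF (exprn_gt0 _ _)) ?invr_gt0 // orbF.
  move=> half0; right; exists (prefix_word x k).
    by apply: represents_half => //; lra.
  by rewrite xk1; apply: represents_half => //; lra.
have d0 : d = false.
  case: d xd yd => // xd yd; exfalso.
  have : (theta (skip k y) - theta (skip k x)) * 2^-1 ^+ (k - j.+1) >= 0.
    by rewrite mulr_ge0 ?exprn_ge0 ?invr_ge0 //; lra.
  by rewrite -D xd yd /=; lra.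
right; exists (prefix_word x j).
  exists false; split; rewrite ?begins_prefix ?size_mkseq //.
    exact: loop_neq_side.
  move: xd; rewrite d0 => /theta_eq_bool xd i ji.
  by rewrite -(xd (i - j.+1)%N) /skip subnKC.
exists true; split; rewrite ?size_mkseq //.
- by apply/agree_prefix => i ij; apply: xy; exact: ltn_trans jk.
- exact: loop_neq_side.
- move: yd; rewrite d0 => /theta_eq_bool yd i ji.
  by rewrite -(yd (i - j.+1)%N) /skip subnKC.
Qed.

Lemma glued_sides x y k : valid x -> agree k x y -> x k != y k ->
  (forall w, stream_coord w x = stream_coord w y) -> (0 < k)%N ->
  theta (skip k x) <= 1 / 2 <= theta (skip k y) -> glued x y.
Proof.
move=> vx xy xyk E k0 half; have [j [jk xj xi]] := last_loop vx k0.
apply: (glued_on_circle xy jk xj xi _ _ half) => //; first exact: glued_loops E.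
by apply: glued_loops (agree_sym xy) _ _; rewrite // eq_sym.
Qed.

(** At the first difference either both letters are loops, and both addresses
    lead to the common root of these loops, or [glued_on_circle] applies. *)
Lemma stream_coord_separates x y : valid x -> valid y ->
  (forall w, stream_coord w x = stream_coord w y) -> glued x y.
Proof.
move=> vx vy E.
have [->|xy] := pselect (x = y); first by left.
have [k ag xyk] := first_difference xy.
have yxk : y k != x k by rewrite eq_sym.
have E' w : stream_coord w y = stream_coord w x by [].
have ag' := agree_sym ag.
have [xk|xk] := boolP (loop (x k)).
  have [yk|yk] := boolP (loop (y k)).
    right; exists (prefix_word x k).
      have [d xd] := glued_loops ag xyk E xk; exists d.
      by split; rewrite ?begins_prefix ?size_mkseq //; exact: loop_neq_side.
    have [d yd] := glued_loops ag' yxk E' yk; exists d.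
    split; rewrite ?size_mkseq //; [exact/agree_prefix|exact: loop_neq_side].
  have k0 : (0 < k)%N.
    by case: k yk {ag xyk yxk ag' xk} => // /negP[]; apply: loop_base; rewrite vy.
  have tx : theta (skip k x) = 1 / 2 by apply: theta_loop; rewrite /skip addn0.
  have ty := theta01 R (skip 1 (skip k y)).
  have := thetaE R (skip k y); rewrite {2}/skip addn0.
  case: (letterP (y k)) => [->|->|yl]; last by rewrite yl in yk.
    rewrite halve_side /= => tyE; apply: glued_sym.
    by apply: (glued_sides vy ag' yxk E' k0); lra.
  by rewrite halve_side /= => tyE; apply: (glued_sides vx ag xyk E k0); lra.
have k0 : (0 < k)%N.
  by case: k xk {ag xyk yxk ag'} => // /negP[]; apply: loop_base; rewrite vx.
have tx := theta01 R (skip 1 (skip k x)).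
have ty := theta01 R (skip 1 (skip k y)).
have := thetaE R (skip k x); have := thetaE R (skip k y).
rewrite {2}/skip addn0 {5}/skip addn0.
case: (letterP (x k)) (xyk) => [->|->|xl]; last by rewrite xl in xk.
  case: (letterP (y k)) => [->|->|yl]; first by rewrite eqxx.
    by rewrite !halve_side /= => _ yE xE; apply: (glued_sides vx ag xyk E k0); lra.
  by rewrite halve_side halve_loop //= => _ yE xE;
    apply: (glued_sides vx ag xyk E k0); lra.
case: (letterP (y k)) => [->|->|yl]; last 1 first.
- by rewrite halve_side halve_loop //= => _ yE xE; apply: glued_sym;
  apply: (glued_sides vy ag' yxk E' k0); lra.
- by rewrite !halve_side /= => _ yE xE; apply: glued_sym;
  apply: (glued_sides vy ag' yxk E' k0); lra.
- by rewrite eqxx.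
Qed.

End Gluing.

(** * The gluing relation *)

Section LimitTopology.
Variables (R : realType) (n : nat).

Notation S := (rabbit_system n).
Notation letter := (alphabet S).
Notation word := (seq letter).
Notation stream := (infinite_words S).
Notation side := (@side n).
Notation theta := (@theta R n).
Notation stream_coord := (@stream_coord R n).
Notation valid := (@valid n).

Lemma stream_coord_near w (x : stream) A : nbhs (stream_coord w x) A ->
  exists k, forall y, agree k x y -> A (stream_coord w y).
Proof.
move=> /(@circle_point_continuous R) /nbhs_ballP[e /= e0 eA].
have [k ke] := pow_half_lt e0; exists (size w + k)%N => y xy.
apply: eA; rewrite /ball /= /ball_ /angle.
have -> : begins w y = begins w x.
  apply/idP/idP; last by apply: agree_begins xy _; exact: leq_addr.
  by apply: agree_begins (agree_sym xy) _; exact: leq_addr.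
case: ifP => _; last by rewrite subrr normr0.
apply: le_lt_trans ke; apply: theta_agree => j jk.
by rewrite /skip xy // ltn_add2l.
Qed.

Lemma circle_hausdorff : hausdorff_space (R * R)%type.
Proof. exact: norm_hausdorff. Qed.

(** [x] and [y] are limits of addresses of common vertices, on which the
    coordinates agree. *)
Lemma share_end_stream_coord (x y : stream) N : valid x -> valid y ->
  (forall k, (N <= k)%N -> share_end (prefix_word x k) (prefix_word y k)) ->
  forall w, stream_coord w x = stream_coord w y.
Proof.
move=> vx vy xy w; apply: contrapT => ne.
have : ~ close (stream_coord w x) (stream_coord w y) by rewrite closeE //;
  exact: circle_hausdorff.
apply; rewrite closeEnbhs => A B /stream_coord_near[i iA] /stream_coord_near[j jB].
pose k := (maxn N (maxn i j)).+1.
have [p [px py]] := xy k (ltac:(by rewrite /k; lia)).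
have ends z : valid z -> p \in [:: word_end false (prefix_word z k);
    word_end true (prefix_word z k)] ->
    exists2 r, agree k z r & represents p r.
  move=> vz pz; have [d ->] : exists d, p = word_end d (prefix_word z k).
    by move: pz; rewrite !inE => /orP[] /eqP->; [exists false|exists true].
  exists (extend (prefix_word z k) d).
    by apply/agree_prefix; exact: begins_extend.
  exists d; apply: extend_represents; first exact: valid_prefix.
  by move=> /(congr1 size); rewrite size_mkseq.
have [r xr pr] := ends x vx px; have [r' yr pr'] := ends y vy py.
exists (stream_coord w r); split.
  by apply: iA => l li; apply: xr; rewrite /k; lia.
rewrite (stream_coord_represents R w pr pr').
by apply: jB => l lj; apply: yr; rewrite /k; lia.
Qed.

Lemma glued_share_end (x y : stream) : glued x y ->
  exists N, forall k, (N <= k)%N -> share_end (prefix_word x k) (prefix_word y k).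
Proof.
case=> [->|[u [d xd] [e ye]]].
  by exists 0%N => k _; exists (word_end false (prefix_word y k)); rewrite !inE eqxx.
exists (size u).+1 => k uk; exists u; rewrite !inE.
have := tail_word_end xd uk; have := tail_word_end ye uk.
by case: (d); case: (e) => -> ->; rewrite eqxx ?orbT.
Qed.

Lemma glued_stream_coord (x y : stream) w : glued x y ->
  stream_coord w x = stream_coord w y.
Proof. by case=> [->//|[u xu yu]]; exact: stream_coord_represents xu yu. Qed.

Lemma symbol_spaceE (x : stream) : symbol_space x <-> valid x.
Proof.
split=> [sx k|vx k k0].
  have /edge_wordE[/(_ k) + _] := sx k.+1 isT.
  by rewrite size_mkseq ltnSn nth_mkseq //; exact.
apply/edge_wordE; split; first exact: valid_prefix.
by move=> /(congr1 size); rewrite size_mkseq; case: k k0.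
Qed.

Lemma gluing_stream_coord (x y : @symbol_space S) :
  gluing x y <-> forall w, stream_coord w (val x) = stream_coord w (val y).
Proof.
have vx : valid (val x) by apply/symbol_spaceE; exact: set_valP.
have vy : valid (val y) by apply/symbol_spaceE; exact: set_valP.
rewrite gluingE; split=> [[N]|E]; first exact: share_end_stream_coord.
by apply: glued_share_end; exact: (stream_coord_separates vx vy E).
Qed.

Lemma same_classE (x y : @symbol_space S) :
  same_class x y <-> forall w, stream_coord w (val x) = stream_coord w (val y).
Proof.
split=> [/asboolP E|E].
  apply/gluing_stream_coord; have : gluing_class y y by apply/gluing_stream_coord.
  by rewrite -E.
apply/asboolP/seteqP; split=> z /gluing_stream_coord zE;
  apply/gluing_stream_coord => w.
  by rewrite -E zE.
by rewrite E zE.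
Qed.

(** Together with [nbhs_agree]: the sets of streams with a given prefix form a
    basis of neighbourhoods. *)
Lemma agree_nbhs k (x : stream) : nbhs x [set y | agree k x y].
Proof.
elim: k => [|k IH]; first by near=> y.
have xk : nbhs x [set y : stream | y k = x k].
  apply: (@proj_continuous nat (fun=> discrete_topology letter) k x [set x k]).
  exact: discrete_set1.
apply: filterS (filterI IH xk) => y [xy yk] j.
by rewrite ltnS leq_eqVlt => /predU1P[->|/xy].
Unshelve. all: by end_near. Qed.

Lemma nbhs_agree (x : stream) U : nbhs x U -> exists k, forall y, agree k x y -> U y.
Proof.
pose F := filter_from [set: nat] (fun k => [set y | agree k x y]).
have FF : Filter F.
  apply: filter_from_filter; first by exists 0%N.
  move=> i j _ _; exists (maxn i j) => // y /= xy.
  by split=> l lk; apply: xy; lia.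
suff : F --> x by move=> /[apply] -[k _ kU]; exists k.
apply/cvg_sup => k A [_ [[V oV <-] Vx] VA].
exists k.+1 => // y xy; apply: VA => /=.
by rewrite -(xy k (ltnSn k)).
Qed.

End LimitTopology.

(** * Topology of the limit space *)

Section LimitSpace.
Variables (R : realType) (n : nat).
Hypothesis n_gt1 : (1 < n)%N.

Notation S := (rabbit_system n).
Notation letter := (alphabet S).
Notation word := (seq letter).
Notation stream := (infinite_words S).
Notation side := (@side n).
Notation theta := (@theta R n).
Notation stream_coord := (@stream_coord R n).
Notation valid := (@valid n).
Notation X := (limit_space S).

Definition base_loop : letter := inl (Ordinal (ltnW n_gt1)).

Lemma valid_default : valid (extend [:: base_loop] false).
Proof. by apply: valid_extend => // -[|k]. Qed.

Definition default_point : @symbol_space S :=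
  @exist _ (fun x => x \in @symbol_space S) _
    (mem_set ((symbol_spaceE _).2 valid_default)).

(** Made total by sending the streams outside the symbol space to an arbitrary
    point. *)
Definition point_at (x : stream) : X := \pi_X (insubd default_point x).

Lemma val_insubd_valid (x : stream) : valid x -> val (insubd default_point x) = x.
Proof. by move=> vx; rewrite insubdK //; apply/mem_set/symbol_spaceE. Qed.

Lemma point_at_onto (z : X) : exists2 x, valid x & point_at x = z.
Proof.
have vz : valid (val (repr z)) by apply/symbol_spaceE; exact: set_valP.
by exists (val (repr z)) => //; rewrite /point_at valKd reprK.
Qed.

Lemma point_at_eq (x y : stream) : valid x -> valid y ->
  point_at x = point_at y <-> forall w, stream_coord w x = stream_coord w y.
Proof.
move=> vx vy; rewrite /point_at.
have := same_classE R (insubd default_point x) (insubd default_point y).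
rewrite !val_insubd_valid // => <-.
by split=> [/eqmodP//|xy]; apply/eqmodP.
Qed.

Lemma open_limitP (U : set X) : open U <->
  forall x, valid x -> U (point_at x) ->
    exists k, forall y, valid y -> agree k x y -> U (point_at y).
Proof.
split=> [oU x vx Ux|H].
  have /= := oU; rewrite /open /= /quotient_open => -[V oV VU].
  have Vx : V x.
    have : (\pi_X @^-1` U) (insubd default_point x) by [].
    by rewrite -VU /preimage /= [X in V X](val_insubd_valid vx).
  have [k kV] := nbhs_agree (open_nbhs_nbhs (conj oV Vx)).
  exists k => y vy xy; rewrite /point_at -[U _]/((\pi_X @^-1` U) _) -VU.
  by rewrite /preimage /= [X in V X](val_insubd_valid vy); exact: kV.
rewrite /open /= /quotient_open openE => s Us.
have vs : valid (val s) by apply/symbol_spaceE; exact: set_valP.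
have [|k kU] := H _ vs; first by rewrite /point_at valKd.
have : nbhs s (val @^-1` [set y : stream | agree k (val s) y]).
  by apply: initial_continuous; exact: agree_nbhs.
apply: filterS => t /= st.
have vt : valid (val t) by apply/symbol_spaceE; exact: set_valP.
by have := kU _ vt st; rewrite /point_at valKd.
Qed.

Lemma stream_closed (A : set stream) :
  (forall x, ~ A x -> exists k, forall y, agree k x y -> ~ A y) -> closed A.
Proof.
move=> H; rewrite -[X in closed X]setCK; apply: open_closedC;
  rewrite openE => x /= nAx.
have [k kA] := H x nAx.
exact: filterS kA (agree_nbhs k x).
Qed.

Lemma valid_closed : closed [set x : stream | valid x].
Proof.
apply: stream_closed => x nvx.
have [k xk] : exists k, ~ (is_base (x k) = (k == 0)%N).
  by apply: contrapT => nk; apply: nvx => k; apply: contrapT => ?; apply: nk;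
    exists k.
by exists k.+1 => y xy vy; apply: xk; rewrite xy.
Qed.

Lemma stream_compact : compact [set: stream].
Proof.
have fin : compact [set: discrete_topology letter].
  by apply: finite_compact; exact: (@finite_finset letter).
have := @tychonoff nat (fun=> discrete_topology letter) (fun=> setT) (fun=> fin).
by congr compact; apply/seteqP; split.
Qed.

Lemma limit_image_compact (A : set stream) : closed A ->
  A `<=` [set x | valid x] -> compact (point_at @` A).
Proof.
move=> cA Av; have := subclosed_compact cA stream_compact (@subsetT _ _).
apply: continuous_compact; apply/subspace_continuousP => x Ax U.
rewrite nbhsE => -[V [/open_limitP oV Vx] VU].
have [k kV] := oV x (Av x Ax) Vx.
rewrite /within /=; apply: filterS (agree_nbhs k x) => y xy Ay.
by apply/VU/kV => //; exact: Av.
Qed.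

Lemma limit_compact : compact [set: X].
Proof.
have -> : [set: X] = point_at @` [set x : stream | valid x].
  by apply/seteqP; split=> // z _; have [x] := point_at_onto z; exists x.
by apply: limit_image_compact => //; exact: valid_closed.
Qed.

End LimitSpace.

(** * Cells, vertices and branches *)

Section Cells.
Variables (R : realType) (n : nat).
Hypothesis n_gt1 : (1 < n)%N.

Notation S := (rabbit_system n).
Notation letter := (alphabet S).
Notation word := (seq letter).
Notation stream := (infinite_words S).
Notation side := (@side n).
Notation theta := (@theta R n).
Notation stream_coord := (@stream_coord R n).
Notation circle_point := (@circle_point R).
Notation valid := (@valid n).
Notation X := (limit_space S).
Notation L := (@point_at n n_gt1).
Notation base_loop := (base_loop n_gt1).

Lemma represents_inj (u v : word) (x : stream) : represents u x ->
  represents v x -> u = v.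
Proof.
have le_size (u' v' : word) : represents u' x -> represents v' x ->
    (size u' <= size v')%N.
  move=> [d [_ xu xd]] [e [_ xv xe]]; rewrite leqNgt; apply/negP => vu.
  have de : side d = side e.
    rewrite -(xd (size u').+1) ?ltnSn // -(xe (size u').+1) //.
    exact: leq_trans vu (leqnSn _).
  by move: xu; rewrite de xe // eqxx.
move=> ux vx; have suv : size u = size v.
  by apply/eqP; rewrite eqn_leq !le_size.
have [_ [/eqP <- _ _]] := ux; have [_ [/eqP <- _ _]] := vx.
by rewrite suv.
Qed.

Lemma valid_begins (w : word) (x : stream) : valid x -> begins w x -> valid_word w.
Proof. by move=> vx /eqP <-; exact: valid_prefix. Qed.

Lemma word_end_take d (w : word) :
  exists k, word_end d w = take k w /\ (k <= (size w).-1)%N.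
Proof.
elim/last_ind: w => [|w c [k [wE kw]]]; first by exists 0%N.
rewrite word_end_rcons size_rcons; case: eqP => _.
  exists k; rewrite wE -cats1 take_cat; split; last by move: kw; lia.
  case: ltnP => // wk; have -> : (k - size w = 0)%N by lia.
  by rewrite take0 cats0 take_oversize.
by exists (size w); rewrite -cats1 take_size_cat.
Qed.

Lemma valid_word_take k (w : word) : valid_word w -> valid_word (take k w).
Proof. by rewrite -{1}(cat_take_drop k w) => /valid_word_cat. Qed.

Lemma valid_word_end d (w : word) : valid_word w -> valid_word (word_end d w).
Proof. by have [k [-> _]] := word_end_take d w; exact: valid_word_take. Qed.

Lemma size_word_end d (w : word) : w <> [::] -> (size (word_end d w) < size w)%N.
Proof.
by have [k [-> kw]] := word_end_take d w; rewrite size_take_min gtn_min;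
  case: w kw => //= a w; rewrite -ltnS => ->.
Qed.

Lemma point_at_glued (x y : stream) : valid x -> valid y ->
  L x = L y <-> glued x y.
Proof.
move=> vx vy; rewrite (point_at_eq R n_gt1 vx vy); split.
  exact: stream_coord_separates.
by move=> xy w; exact: glued_stream_coord.
Qed.

(** One of the addresses of the vertex [u]; the base vertex has loops only. *)
Definition vertex_stream (u : word) : stream :=
  extend (rcons u (if u is [::] then base_loop else side false)) true.

Definition vertex (u : word) : X := L (vertex_stream u).

Lemma valid_rcons_side (u : word) d : valid_word u -> u <> [::] ->
  valid_word (rcons u (side d)).
Proof. by move=> vu u0; apply/valid_rcons; split=> //; case: u u0 {vu}. Qed.

Lemma extend_rcons_tail (u : word) c d : c != side d ->
  tail u d (extend (rcons u c) d).
Proof.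
move=> cd; have := begins_extend (rcons u c) d;
  rewrite begins_rcons => /andP[ux /eqP xu].
by split=> //; [rewrite xu|move=> k uk; rewrite /extend nth_default // size_rcons].
Qed.

Lemma vertex_stream_tail (u : word) : tail u true (vertex_stream u).
Proof.
apply: extend_rcons_tail; case: u => [|_ _]; last by rewrite (inj_eq (@side_inj n)).
by apply: loop_neq_side; exact: loop_base.
Qed.

Lemma vertex_stream_represents (u : word) : represents u (vertex_stream u).
Proof. by exists true; exact: vertex_stream_tail. Qed.

Lemma valid_vertex_stream (u : word) : valid_word u -> valid (vertex_stream u).
Proof.
move=> vu; apply: valid_extend; last by case: (u).
by apply/valid_rcons; split=> //; case: u vu.
Qed.

Lemma vertexE (u : word) (x : stream) : valid x -> represents u x -> L x = vertex u.
Proof.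
move=> vx ux; have vu : valid_word u by have [d [ub _ _]] := ux;
  exact: valid_begins ub.
apply/point_at_glued => //; first exact: valid_vertex_stream.
by right; exists u => //; exact: vertex_stream_represents.
Qed.

Lemma point_at_eqP (x y : stream) : valid x -> valid y -> L x = L y -> x <> y ->
  exists2 u, represents u x & represents u y.
Proof. by move=> vx vy /(point_at_glued vx vy)[]. Qed.

Lemma vertex_represents (u : word) (x : stream) : valid x -> valid_word u ->
  L x = vertex u -> represents u x.
Proof.
move=> vx vu /point_at_glued[//||->|[v vx' /represents_inj uv]].
- exact: valid_vertex_stream.
- exact: vertex_stream_represents.
- by rewrite -(uv u (vertex_stream_represents u)).
Qed.

Lemma vertex_inj (u v : word) : valid_word u -> valid_word v ->
  vertex u = vertex v -> u = v.
Proof.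
move=> vu vv uv; apply: represents_inj (vertex_stream_represents u) _.
by apply: vertex_represents => //; exact: valid_vertex_stream.
Qed.

Definition cell (w : word) : set X :=
  [set z | exists x, [/\ valid x, begins w x & L x = z]].

Lemma cell_vertex (w : word) : valid_word w -> cell w (vertex w).
Proof.
move=> vw; exists (vertex_stream w); split=> //; first exact: valid_vertex_stream.
by have [] := vertex_stream_tail w.
Qed.

Lemma cell_parent (u : word) c : valid_word (rcons u c) ->
  cell (rcons u c) (vertex u).
Proof.
move=> vuc; have [d cd] : exists d, c != side d.
  have [->|c0] := eqVneq c (side false); last by exists false.
  by exists true; rewrite (inj_eq (@side_inj n)).
have ve : valid (extend (rcons u c) d) by apply: valid_extend => //; case: (u).
exists (extend (rcons u c) d); split=> //; first exact: begins_extend.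
by apply: vertexE => //; exists d; exact: extend_rcons_tail.
Qed.

Lemma cell_word_end d (w : word) : valid_word w -> w <> [::] ->
  cell w (vertex (word_end d w)).
Proof.
move=> vw w0; have ve := valid_extend d vw w0.
exists (extend w d); split=> //; first exact: begins_extend.
by apply: vertexE => //; exists d; exact: extend_represents.
Qed.

Lemma cell_cover (z : X) k : exists w, [/\ valid_word w, size w = k & cell w z].
Proof.
have [x vx xz] := point_at_onto n_gt1 z; exists (prefix_word x k).
split; [exact: valid_prefix|by rewrite size_mkseq|].
by exists x; split=> //; exact: begins_prefix.
Qed.

(** By [limit_coordE] this is the map induced by [stream_coord]. It retracts
    the limit space onto the circle of [w] when [w] is a loop word. *)
Definition limit_coord (w : word) (z : X) : R * R := stream_coord w (val (repr z)).

Lemma limit_coordE (w : word) (x : stream) : valid x ->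
  limit_coord w (L x) = stream_coord w x.
Proof.
move=> vx; rewrite /limit_coord; have vr : valid (val (repr (L x))).
  by apply/symbol_spaceE; exact: set_valP.
suff /(point_at_eq R n_gt1 vr vx) : L (val (repr (L x))) = L x by exact.
by rewrite {1}/point_at valKd reprK.
Qed.

Lemma limit_coord_continuous (w : word) : continuous (limit_coord w).
Proof.
apply/continuousP => A oA; apply/open_limitP => x vx;
  rewrite /preimage /= limit_coordE // => Ax.
have [k kA] := stream_coord_near (open_nbhs_nbhs (conj oA Ax)).
by exists k => y vy /kA; rewrite limit_coordE.
Qed.

Lemma limit_coord_inj (z t : X) :
  (forall w, limit_coord w z = limit_coord w t) -> z = t.
Proof.
have [x vx <-] := point_at_onto n_gt1 z.
have [y vy <-] := point_at_onto n_gt1 t.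
by move=> E; apply/(point_at_eq R n_gt1 vx vy) => w; rewrite -!limit_coordE.
Qed.

Lemma limit_coord_unit (w : word) z : @unit_circle R (limit_coord w z).
Proof. exact: circle_point_unit. Qed.

Lemma limit_hausdorff : hausdorff_space X.
Proof.
move=> z t zt; apply: limit_coord_inj => w; apply: (@circle_hausdorff R) => A B zA tB.
have [y [Ay By]] := zt _ _ (limit_coord_continuous zA) (limit_coord_continuous tB).
by exists (limit_coord w y).
Qed.

Lemma limit_metrizable : metrizable R X.
Proof.
pose f k (z : X) : R := if @unpickle (word * bool)%type k is Some (w, b)
  then (if b then (limit_coord w z).1 else (limit_coord w z).2) else 0.
apply: (@metrizable_of_separating _ _ f).
- exact: limit_compact.
- move=> k; rewrite /f; case: unpickle => [[w b]|]; last exact: cst_continuous.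
  move=> z; case: b; apply: continuous_comp (@limit_coord_continuous w z) _;
    [exact: cvg_fst|exact: cvg_snd].
- move=> k z; rewrite /f; case: unpickle => [[w b]|]; last by rewrite normr0.
  rewrite ler_norml; case: b; rewrite /limit_coord /stream_coord /=.
    by rewrite cos_geN1 cos_le1.
  by rewrite sin_geN1 sin_le1.
- move=> z t E; apply: limit_coord_inj => w.
  have := E (pickle (w, true)); have := E (pickle (w, false)).
  by rewrite /f !pickleK; case: (limit_coord w z) => a b;
    case: (limit_coord w t) => a' b' /= -> ->.
Qed.

Lemma begins_closed (w : word) : closed [set x : stream | begins w x].
Proof.
apply: stream_closed => x nwx; exists (size w) => y xy wy; apply: nwx.
exact: agree_begins (agree_sym xy) _ wy.
Qed.

Lemma cell_closed (w : word) : closed (cell w).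
Proof.
have -> : cell w = L @` ([set x | valid x] `&` [set x | begins w x]).
  by apply/seteqP; split=> [z [x [vx wx xz]]|z [x [vx wx] xz]]; exists x.
apply: compact_closed limit_hausdorff _; apply: limit_image_compact;
  last by move=> x [].
by apply: closedI; [exact: valid_closed|exact: begins_closed].
Qed.

(** For a loop word [rcons u c], this is the cell of that word minus the
    vertex [u] (see [branch_closure]), which will be a component of the
    complement of this vertex. *)
Definition branch (w : word) : set X := [set z | limit_coord w z <> circle_point 0].

Lemma branch_open (w : word) : open (branch w).
Proof.
have : open (limit_coord w @^-1` (~` [set circle_point 0])).
  move/continuousP: (@limit_coord_continuous w); apply; apply: closed_openC.
  exact: accessible_closed_set1 (hausdorff_accessible (@circle_hausdorff R)) _.
by [].
Qed.

Lemma branch_sub_cell (w : word) : branch w `<=` cell w.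
Proof.
move=> z; have [x vx <-] := point_at_onto n_gt1 z;
  rewrite /branch /= limit_coordE // => xw.
exists x; split=> //; apply: contrapT => /negP;
  exact: (fun h => xw (stream_coord_not_begins R h)).
Qed.

Lemma branch_shorter_vertex (w u : word) : valid_word u -> (size u < size w)%N ->
  ~ branch w (vertex u).
Proof.
move=> vu uw; apply; rewrite /vertex limit_coordE; last exact: valid_vertex_stream.
by apply: stream_coord_end; apply: angle_tail (vertex_stream_tail u) uw.
Qed.

Lemma cell_branch (u : word) c z : loop c -> cell (rcons u c) z ->
  z <> vertex u -> branch (rcons u c) z.
Proof.
move=> cl [x [vx ucx <-]] xu E; apply: xu; apply: vertexE => //.
move: ucx (ucx); rewrite {1}begins_rcons => /andP[ux /eqP xc] ucx.
have E' : stream_coord (prefix_word x (size u).+1) x = circle_point 0.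
  by rewrite -limit_coordE // -E; congr limit_coord; move/eqP: ucx;
    rewrite size_rcons.
have xl : loop (x (size u)) by rewrite xc.
have [d xd] := loop_tail xl E'.
by exists d; split=> //; exact: loop_neq_side.
Qed.

Lemma branch_closure (u : word) c : loop c -> valid_word (rcons u c) ->
  vertex u |` branch (rcons u c) = cell (rcons u c).
Proof.
move=> cl vuc; apply/seteqP; split=> z.
  by move=> [->|]; [exact: cell_parent|exact: branch_sub_cell].
by move=> zc; have [->|zu] := pselect (z = vertex u); [left|right;
  exact: cell_branch].
Qed.

(** The root is the only boundary point of a branch, so it cannot be avoided
    on the way out. *)
Lemma connected_branch (A : set X) (u : word) c : loop c -> valid_word (rcons u c) ->
  connected A -> A `&` branch (rcons u c) !=set0 -> ~ A (vertex u) ->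
  A `<=` branch (rcons u c).
Proof.
move=> cl vuc; apply: connected_boundary; first exact: branch_open.
by rewrite branch_closure //; exact: cell_closed.
Qed.

(** * Connectedness *)

Lemma cell_child (v : word) z : cell v z -> exists c,
  valid_word (rcons v c) /\ cell (rcons v c) z.
Proof.
move=> [x [vx wx xz]]; exists (x (size v)).
have bx : begins (rcons v (x (size v))) x by rewrite begins_rcons wx eqxx.
by split; [exact: valid_begins bx|exists x].
Qed.

(** Dependent choice along the tree of words. *)
Lemma word_path (Q : word -> Prop) (w : word) : valid_word w -> w <> [::] -> Q w ->
  (forall v, valid_word v -> Q v -> exists c,
    valid_word (rcons v c) /\ Q (rcons v c)) ->
  exists x, [/\ valid x, begins w x & forall k,
    (size w <= k)%N -> Q (prefix_word x k)].
Proof.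
move=> vw w0 Qw child.
have child' v : exists c, valid_word v /\ Q v ->
    valid_word (rcons v c) /\ Q (rcons v c).
  have [[vv Qv]|nv] := pselect (valid_word v /\ Q v); last by exists (side false).
  by have [c] := child v vv Qv; exists c.
have [next nextP] := choice child'.
pose v k := iter k (fun u => rcons u (next u)) w.
have vP k : valid_word (v k) /\ Q (v k) by elim: k => //= k; exact: nextP.
have sv k : size (v k) = (size w + k)%N.
  by elim: k => [|k IH]; rewrite /= ?addn0 // size_rcons IH addnS.
have vpre i j : (i <= j)%N -> take (size (v i)) (v j) = v i.
  move=> /subnK <-; elim: (j - i)%N => [|m IH]; first exact: take_size.
  by rewrite /= -cats1 takel_cat ?IH // !sv; lia.
pose x : stream := fun j => nth (side false) (v j.+1) j.
have xpre k : prefix_word x (size (v k)) = v k.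
  apply: (@eq_from_nth _ (side false)); rewrite size_mkseq // => j jk.
  rewrite nth_mkseq // /x; have [kj|jk1] := leqP k j.+1.
    by rewrite -(vpre _ _ kj) nth_take.
  by rewrite -[in LHS](vpre j.+1 k (ltnW jk1)) nth_take // sv; lia.
exists x; split.
- move=> j; have [/(_ j) + _] := vP j.+1; rewrite -xpre size_mkseq.
  by rewrite sv nth_mkseq ?sv; [apply; lia|lia].
- by rewrite /begins; have := xpre 0%N => /= ->.
- move=> k wk; have [_] := vP (k - size w)%N.
  by rewrite -{1}xpre sv subnKC.
Qed.

(** Let [B] be clopen in the cell. If [B] does not split any child of a cell,
    it does not split this cell, because the children share a vertex. So a
    cell split by [B] contains a nested sequence of such cells; but deep cells
    around the limit of this sequence are inside or outside [B]. *)
Lemma cell_connected (w : word) : valid_word w -> w <> [::] -> connected (cell w).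
Proof.
move=> vw w0 B [b Bb] [C oC BC] [D cD BD].
pose mono v := forall z t, cell v z -> cell v t -> B z -> B t.
suff wmono : mono w.
  apply/seteqP; split=> [z|z wz]; first by rewrite BC => -[].
  by apply: wmono wz (Bb); move: Bb; rewrite BC => -[].
apply: contrapT => nw.
have [|x [vx wx nmono]] := @word_path (fun v => ~ mono v) w vw w0 nw.
  move=> v vv nv; apply: contrapT => nc; apply: nv => z t vz vt Bz.
  have child_mono c : valid_word (rcons v c) -> mono (rcons v c).
    by move=> vc; apply: contrapT => nm; apply: nc; exists c.
  have [c [vc zc]] := cell_child vz; have [d [vd td]] := cell_child vt.
  apply: (child_mono d vd) td _ => //; first exact: cell_parent.
  by apply: (child_mono c vc) zc _ Bz => //; exact: cell_parent.
have sub_w v : (size w <= size v)%N -> begins v x -> cell v `<=` cell w.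
  move=> wv bv z [y [vy by_ yz]]; exists y; split=> //.
  exact: agree_begins (begins_agree bv by_) wv wx.
have wLx : cell w (L x) by exists x.
have [Bx|nBx] := pselect (B (L x)).
  have Cx : C (L x) by move: Bx; rewrite BC => -[].
  have [k kC] := (open_limitP n_gt1 C).1 oC x vx Cx.
  apply: (nmono (maxn k (size w))) => [|z t _ [y [vy by_ <-]] _]; first by lia.
  rewrite BC; split.
    have wk : (size w <= size (prefix_word x (maxn k (size w))))%N.
      by rewrite size_mkseq leq_maxr.
    by apply: (sub_w _ wk (begins_prefix x _)); exists y.
  apply: kC => // j jk; have /agree_prefix := by_; apply; lia.
have Dx : (~` D) (L x) by move=> Dx; apply: nBx; rewrite BD.
have [k kD] := (open_limitP n_gt1 _).1 (closed_openC cD) x vx Dx.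
apply: (nmono (maxn k (size w))) => [|z t [y [vy by_ <-]] _]; first by lia.
rewrite BD => -[_ Dy]; exfalso; apply: (kD y vy) Dy.
by move=> j jk; have /agree_prefix := by_; apply; lia.
Qed.

Lemma limit_connected : connected [set: X].
Proof.
have -> : [set: X] =
    \bigcup_(w in [set w : word | valid_word w /\ size w = 1%N]) cell w.
  apply/seteqP; split=> // z _; have [w [vw w1 wz]] := cell_cover z 1.
  by exists w.
apply: bigcup_connected => [|w [vw w1]]; last by apply: cell_connected => //;
  case: w w1 {vw}.
exists (vertex [::]) => w [vw w1].
case: w w1 vw => // c [|//] _ vc; exact: (@cell_parent [::]).
Qed.

(** A point has finitely many addresses, and some depth works for each of
    them. *)
Lemma cells_small (z : X) (U : set X) : open U -> U z ->
  exists k, forall w, (k <= size w)%N -> cell w z -> cell w `<=` U.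
Proof.
move=> /(open_limitP n_gt1) oU Uz; have [x vx xz] := point_at_onto n_gt1 z.
have Ux : U (L x) by rewrite xz.
have [k kU] := oU x vx Ux.
have [[u ux]|nu] := pselect (exists u, represents u x); last first.
  exists k => w wk [y [vy wy yz]] _ [y' [vy' wy' <-]].
  have yx : y = x.
    apply: contrapT => yx; have [|u uy ux] := point_at_eqP vy vx _ yx.
      by rewrite yz xz.
    by apply: nu; exists u.
  apply: kU => // j jk; rewrite -yx.
  by apply: (begins_agree wy wy'); exact: leq_trans jk wk.
pose rep (p : letter * bool) := extend (rcons u p.1) p.2.
have near_rep p : exists k, valid (rep p) -> U (L (rep p)) ->
    forall y, valid y -> agree k (rep p) y -> U (L y).
  have [[vp Up]|np] := pselect (valid (rep p) /\ U (L (rep p))).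
    by have [m mU] := oU _ vp Up; exists m.
  by exists 0%N => vp Up; case: np.
have [K KP] := choice near_rep.
(* All the addresses of the vertex [u] are of the form [rep p]. *)
exists (\max_p K p)%N => w wK [y [vy wy yz]] _ [y' [vy' wy' <-]].
have uy : represents u y.
  have [->//|yx] := pselect (y = x); have [|v vy1 vx1] := point_at_eqP vy vx _ yx.
    by rewrite yz xz.
  by rewrite (represents_inj ux vx1).
have [d [/beginsP uby _ yd]] := uy.
have yE : y = rep (y (size u), d).
  apply/funext => j; rewrite /rep /extend nth_rcons /=.
  case: ltngtP => [ju|uj|->//]; last by rewrite yd.
  by rewrite uby //; apply: set_nth_default.
apply: (KP (y (size u), d)) => //; rewrite -yE //; first by rewrite yz.
move=> j jK; apply: (begins_agree wy wy'); apply: leq_trans jK (leq_trans _ wK).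
exact: (@leq_bigmax _ K).
Qed.

(** The union of the cells of a given depth that contain [z] is connected. It
    is a neighbourhood of [z] because the other cells of this depth are closed
    and finite in number. *)
Lemma limit_locally_connected : locally_connected X.
Proof.
apply: locally_connected_of_nbhs => z A zA.
have [U [oU Uz] UA] : exists2 U, open_nbhs z U & U `<=` A by move: zA; rewrite nbhsE.
have [k kU] := cells_small oU Uz.
pose P := [set w : word | [/\ valid_word w, size w = k.+1 & cell w z]].
exists (\bigcup_(w in P) cell w); split.
- pose far := [set w : word | [/\ size w = k.+1 & ~ cell w z]].
  have far_fin : finite_set far.
    apply: (@sub_finite_set _ _ [set tval t | t in [set: k.+1.-tuple letter]]).
      by move=> w [wk _]; exists (Tuple (introT eqP wk)).
    by apply: finite_image; exact: finite_finset.
  have : open (~` \bigcup_(w in far) cell w).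
    apply: closed_openC; apply: closed_bigcup => // w _; exact: cell_closed.
  move=> of_; have nz : nbhs z (~` \bigcup_(w in far) cell w).
    by apply: open_nbhs_nbhs; split=> // -[w [_ nwz] wz].
  apply: filterS nz => t nt; have [w [vw wk wt]] := cell_cover t k.+1.
  exists w => //; split=> //; apply: contrapT => nwz; apply: nt.
  by exists w.
- apply: bigcup_connected => [|w [vw wk _]]; first by exists z => w [].
  by apply: cell_connected => //; case: w wk {vw}.
- by move=> t [w [_ wk wz] wt]; apply: UA; apply: kU wz _ wt; rewrite wk.
Qed.

(** * Order of points *)

Definition joined (p y z : X) : Prop := connected_component (~` [set p]) y z.

Lemma joined_trans p y z t : joined p y z -> joined p z t -> joined p y t.
Proof. exact: connected_component_trans. Qed.

Lemma joined_sym p y z : joined p y z -> joined p z y.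
Proof. exact: connected_component_sym. Qed.

Lemma joined_cell p (w : word) y z : valid_word w -> w <> [::] -> ~ cell w p ->
  cell w y -> cell w z -> joined p y z.
Proof.
move=> vw w0 wp wy wz; exists (cell w) => //; split=> //; last exact: cell_connected.
by move=> t wt tp; apply: wp; rewrite -tp.
Qed.

(** The two halves of an edge [u] meet at the vertex [u] only, and also at the
    root of [u] when [u] is a loop. *)
Lemma cell_sides (p : X) (u : word) : valid_word u ->
  cell (rcons u (side false)) p -> cell (rcons u (side true)) p ->
  p = vertex u \/ exists v c, [/\ loop c, u = rcons v c & p = vertex v].
Proof.
move=> vu [x [vx]]; rewrite begins_rcons => /andP[ux /eqP xu] xp.
move=> [y [vy]]; rewrite begins_rcons => /andP[uy /eqP yu] yp.
have xy : x <> y by move=> xy; move: xu; rewrite xy yu => /(@side_inj n).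
have [|v vx1 vy1] := point_at_eqP vx vy _ xy; first by rewrite xp.
have pv : p = vertex v by rewrite -xp; exact: vertexE.
have [d [vx2 xd0 xd]] := vx1; have [e [vy2 ye0 ye]] := vy1.
have vu_le : (size v <= size u)%N.
  rewrite leqNgt; apply/negP => uv.
  have := begins_agree vx2 vy2 uv; rewrite xu yu => /(@side_inj n); by [].
have uE : size v = size u -> p = vertex u.
  move=> suv; rewrite pv; congr vertex.
  by move/eqP: vx2 => <-; rewrite suv; move/eqP: ux.
have [/uE pu|vu_lt] : size v = size u \/ (size v < size u)%N by lia.
  by left.
right; have xd1 : d = false by apply: (@side_inj n); rewrite -(xd _ vu_lt).
have ye1 : e = true by apply: (@side_inj n); rewrite -(ye _ vu_lt).
have xy_u := begins_agree ux uy.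
have su : size u = (size v).+1.
  apply/eqP; rewrite eqn_leq vu_lt andbT leqNgt; apply/negP => vu1.
  by have := xy_u _ vu1; rewrite xd // ye // xd1 ye1 => /(@side_inj n).
exists v, (x (size v)); split=> //.
  case: (letterP (x (size v))) => // E; exfalso.
    by move: xd0; rewrite E xd1 eqxx.
  by move: ye0; rewrite -(xy_u _ vu_lt) E ye1 eqxx.
move/eqP: ux => <-; rewrite su prefix_wordS; congr rcons.
by move/eqP: vx2.
Qed.

(** Climb from [u] to an end of the edge [u], through a half of this edge that
    avoids [p]. By [cell_sides], both halves contain [p] only if [u] is a loop
    with root [p]. *)
Lemma joined_vertex (p : X) (u : word) : valid_word u -> vertex u <> p ->
  joined p (vertex [::]) (vertex u) \/
  exists v c, [/\ loop c, valid_word (rcons v c), p = vertex v &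
    joined p (vertex (rcons v c)) (vertex u)].
Proof.
have refl z : z <> p -> joined p z z by move=> zp; apply: connected_component_refl.
have [m] := ubnP (size u); elim: m u => // m IH u um vu up.
have [u0|/eqP u0] := eqVneq u [::]; first by left; rewrite u0 in up *; exact: refl.
have [[d nd]|/forallNP nd] := pselect (exists d, ~ cell (rcons u (side d)) p);
  last first.
  have in_cell d : cell (rcons u (side d)) p by apply: contrapT; exact: nd.
  have [pu|[v [c [cl uE pv]]]] := cell_sides vu (in_cell false) (in_cell true).
    by case: up.
  by right; exists v, c; rewrite -uE; split=> //; exact: refl.
have vud : valid_word (rcons u (side d)) by exact: valid_rcons_side.
have ne : rcons u (side d) <> [::] by case: (u).
have link : joined p (vertex (word_end d u)) (vertex u).
  apply: (joined_cell vud ne nd); last exact: cell_parent.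
  have -> : word_end d u = word_end d (rcons u (side d)).
    by rewrite word_end_rcons eqxx.
  exact: cell_word_end.
have ep : vertex (word_end d u) <> p.
  by move/connected_component_sub: (joined_sym link).
have lt : (size (word_end d u) < m)%N.
  by apply: leq_trans (size_word_end _ u0) _; rewrite -ltnS.
have [J|[v [c [cl vc pv J]]]] := IH _ lt (valid_word_end vu) ep.
  by left; exact: joined_trans J link.
by right; exists v, c; split=> //; exact: joined_trans J link.
Qed.

(** Some cell that contains [y] avoids [p], so that [y] is joined to a
    vertex. *)
Lemma joined_point (p y : X) : y <> p ->
  joined p (vertex [::]) y \/
  exists v c, [/\ loop c, valid_word (rcons v c), p = vertex v &
    joined p (vertex (rcons v c)) y].
Proof.
move=> yp; have [x vx xy] := point_at_onto n_gt1 y.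
have op : open (~` [set p]).
  apply: closed_openC.
  exact: accessible_closed_set1 (hausdorff_accessible limit_hausdorff) _.
have [|k kp] := (open_limitP n_gt1 _).1 op x vx; first by rewrite /= xy.
pose w := prefix_word x k.+1.
have vw : valid_word w by exact: valid_prefix.
have w0 : w <> [::] by move=> /(congr1 size); rewrite size_mkseq.
have wy : cell w y by exists x; split=> //; exact: begins_prefix.
have wp : ~ cell w p.
  move=> [t [vt wt tp]]; apply: (kp t vt) => //.
  by move=> j jk; have /agree_prefix := wt; apply; exact: ltnW.
have wp' : vertex w <> p by move=> E; apply: wp; rewrite -E; exact: cell_vertex.
have link := joined_cell vw w0 wp (cell_vertex vw) wy.
have [J|[v [c [cl vc pv J]]]] := joined_vertex vw wp'.
  by left; exact: joined_trans J link.
by right; exists v, c; split=> //; exact: joined_trans J link.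
Qed.

(** The component of [y] is connected and avoids the root of the branch. *)
Lemma joined_branch (u : word) c y z : loop c -> valid_word (rcons u c) ->
  branch (rcons u c) y -> joined (vertex u) y z -> branch (rcons u c) z.
Proof.
move=> cl vuc by_ J.
have := @connected_branch (connected_component (~` [set vertex u]) y) u c cl vuc.
apply=> //; first exact: component_connected.
- exists y; split=> //; apply: connected_component_refl => /= yu.
  have [vu _] := (valid_rcons u c).1 vuc.
  by apply: (@branch_shorter_vertex (rcons u c) u vu); rewrite ?size_rcons -?yu.
- by move/connected_component_sub => /=; apply.
Qed.

Lemma branch_vertex (u : word) c : loop c -> valid_word (rcons u c) ->
  branch (rcons u c) (vertex (rcons u c)).
Proof.
move=> cl vuc; apply: cell_branch => //; first exact: cell_vertex.
have [vu _] := (valid_rcons u c).1 vuc.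
by move=> /vertex_inj => /(_ vuc vu) /(congr1 size); rewrite size_rcons; lia.
Qed.

Lemma branch_disjoint (u : word) c c' z :
  branch (rcons u c) z -> branch (rcons u c') z -> c = c'.
Proof.
have [x vx <-] := point_at_onto n_gt1 z.
rewrite /branch /= !limit_coordE // => xc xc'.
have : begins (rcons u c) x by apply: contrapT => /negP nb; apply: xc;
  exact: stream_coord_not_begins.
have : begins (rcons u c') x by apply: contrapT => /negP nb; apply: xc';
  exact: stream_coord_not_begins.
by rewrite !begins_rcons => /andP[_ /eqP <-] /andP[_ /eqP <-].
Qed.

Lemma joined_base (u : word) c y : loop c -> valid_word (rcons u c) -> u <> [::] ->
  joined (vertex u) (vertex [::]) y -> ~ branch (rcons u c) y.
Proof.
move=> cl vuc u0 J by_; have := joined_branch cl vuc by_ (joined_sym J).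
by apply: branch_shorter_vertex => //; rewrite size_rcons.
Qed.

Lemma joined_vertexP (u : word) (y : X) : valid_word u -> y <> vertex u ->
  (u <> [::] /\ joined (vertex u) (vertex [::]) y) \/
  exists c, [/\ loop c, valid_word (rcons u c),
    joined (vertex u) (vertex (rcons u c)) y & branch (rcons u c) y].
Proof.
move=> vu /joined_point[J|[v [c [cl vc uv J]]]].
  left; split=> // u0; move: J; rewrite u0 => /joined_sym.
  by move/connected_component_sub; apply.
have [vv _] := (valid_rcons v c).1 vc.
rewrite -(vertex_inj vu vv uv) in vc J; right; exists c; split=> //.
by apply: joined_branch J => //; exact: branch_vertex.
Qed.

(** The components are the branches of the [n] base loops. *)
Lemma has_order_base : has_order (vertex [::]) n.
Proof.
rewrite -[X in has_order _ X]card_ord.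
have v0 : @valid_word n [::] by [].
pose c (i : 'I_n) : letter := inl i.
have cl i : loop (c i) by exact: loop_base.
have vc i : valid_word (rcons [::] (c i)) by apply/valid_rcons.
have base_c d : valid_word (rcons [::] d) -> exists i, d = c i.
  by move=> /valid_rcons[_] /=; case: d => // i _; exists i.
apply: (@has_order_of_finite_components _ _ _ (fun i => branch (rcons [::] (c i)))
  (fun i => vertex (rcons [::] (c i)))).
- by move=> i; exact: branch_open.
- move=> i j [z [zi zj]].
  by have [] := branch_disjoint zi zj.
- by move=> i; exact: branch_vertex.
- move=> i y yi; have y0 : y <> vertex [::].
    by move=> y0; apply: (@branch_shorter_vertex (rcons [::] (c i)) [::]);
      rewrite // -y0.
  have [[//]|[d [dl vd J yd]]] := joined_vertexP v0 y0.
  by rewrite (branch_disjoint yi yd).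
- apply/seteqP; split=> [y y0|y [i _ yi] y0].
    have [[//]|[d [dl vd J yd]]] := joined_vertexP v0 y0.
    by have [i di] := base_c d vd; exists i; rewrite // -di.
  by apply: (@branch_shorter_vertex (rcons [::] (c i)) [::]); rewrite // -y0.
Qed.

(** The components are the branches of the [n.-1] loops below [u], and what is
    left, which contains the base vertex. *)
Lemma has_order_vertex (u : word) : valid_word u -> has_order (vertex u) n.
Proof.
move=> vu; have [->|/eqP u0] := eqVneq u [::]; first exact: has_order_base.
suff : has_order (vertex u) #|{: option 'I_n.-1}|.
  by rewrite card_option card_ord prednK // ltnW.
pose c (j : 'I_n.-1) : letter :=
  inr (@Tagged _ tt (fun c => edge (repl (r:=S) c)) (inr j)).
have cl j : loop (c j) by apply/forallP => d; rewrite eq_side.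
have vc j : valid_word (rcons u (c j)).
  by apply/valid_rcons; split=> //; case: (u) u0.
have loop_c d : loop d -> valid_word (rcons u d) -> exists j, d = c j.
  move=> dl /valid_rcons[_]; rewrite size_eq0 (introF eqP u0).
  case: d dl => // -[[] [d|j]] dl _; last by exists j.
  by have := loop_side n d; rewrite dl.
have nbase j : ~ cell (rcons u (c j)) (vertex [::]).
  rewrite -branch_closure // => -[/vertex_inj u0'|].
    by apply: u0; rewrite -u0'.
  by apply: branch_shorter_vertex; rewrite ?size_rcons.
have nvertex j : ~ branch (rcons u (c j)) (vertex u).
  by apply: branch_shorter_vertex; rewrite ?size_rcons.
pose K (o : option 'I_n.-1) := if o is Some j then branch (rcons u (c j))
  else ~` (\bigcup_j cell (rcons u (c j))).
pose b (o : option 'I_n.-1) := if o is Some j then vertex (rcons u (c j)) else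
  vertex [::].
apply: (@has_order_of_finite_components _ _ _ K b).
- case=> [j|] /=; first exact: branch_open.
  apply: closed_openC; apply: closed_bigcup => [|j _]; last exact: cell_closed.
  exact: finite_finset.
- move=> [i|] [j|] [z [zi zj]] //=.
  + by have [->] := branch_disjoint zi zj.
  + by case: zj; exists i => //; exact: branch_sub_cell.
  + by case: zi; exists j => //; exact: branch_sub_cell.
- case=> [j|] /=; first exact: branch_vertex.
  by move=> [j _]; exact: nbase.
- case=> [j|] y /= yK; have yu : y <> vertex u.
  + by move=> yu; apply: (nvertex j); rewrite -yu.
  + have [[_ J]|[d [dl vd J yd]]] := joined_vertexP vu yu.
      by have := joined_base (cl j) (vc j) u0 J.
    by rewrite (branch_disjoint yK yd).
  + move=> yu; apply: yK; rewrite yu.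
    have n1 : (0 < n.-1)%N by case: (n) n_gt1 => [|[]].
    by exists (Ordinal n1) => //; exact: cell_parent.
  + have [[_ J]//|[d [dl vd J yd]]] := joined_vertexP vu yu.
    have [j dj] := loop_c d dl vd; exfalso; apply: yK; exists j => //.
    by rewrite -dj; exact: branch_sub_cell.
- apply/seteqP; split=> [y yu|y [[j|] _ /= yK] yu]; last 2 first.
  + by apply: (nvertex j); rewrite -yu.
  + apply: yK; rewrite yu.
    have n1 : (0 < n.-1)%N by case: (n) n_gt1 => [|[]].
    by exists (Ordinal n1) => //; exact: cell_parent.
  have [yc|nyc] := pselect ((\bigcup_j cell (rcons u (c j))) y); last by exists None.
  by case: yc => j _ yj; exists (Some j) => //=; exact: cell_branch.
Qed.

(** By [joined_point], all other points are joined to the base vertex. *)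
Lemma not_cut_point (p : X) : (forall u, valid_word u -> p <> vertex u) ->
  ~ cut_point p.
Proof.
move=> np; rewrite /cut_point => cp.
have sub : complement_components p `<=` [set connected_component (~` [set p])
  (vertex [::])].
  move=> _ [y yp <-]; have [J|[v [c [_ vc pv _]]]] := joined_point yp.
    by apply/esym; exact: same_connected_component.
  by have [vv _] := (valid_rcons v c).1 vc; case: (np v vv).
have := card_le_trans cp (subset_card_le sub).
by rewrite (card_le_eqr card_set1) card_le_II.
Qed.

Lemma cut_point_has_order (p : X) : cut_point p -> has_order p n.
Proof.
move=> cp; have [[u [vu ->]]|nu] := pselect (exists u, valid_word u /\ p = vertex u).
  exact: has_order_vertex.
by case: (not_cut_point _ cp) => u vu pu; apply: nu; exists u.
Qed.

Lemma vertex_cut_point (u : word) : valid_word u -> cut_point (vertex u).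
Proof.
move=> vu; rewrite /cut_point (card_le_eqr (has_order_vertex vu)).
by rewrite card_le_II.
Qed.

(** * Circles of the limit space *)

(** The points whose address keeps to the edges of one circle after the loop
    word [w]. *)
Definition circle (w : word) : set X :=
  [set z | exists x, [/\ valid x, begins w x,
    (forall k, (size w <= k)%N -> ~~ loop (x k)) & L x = z]].

Lemma circle_sub_cell (w : word) : circle w `<=` cell w.
Proof. by move=> z [x [vx wx _ xz]]; exists x. Qed.

Lemma loop_word_split (w : word) : loop_word w -> exists u c, w = rcons u c /\ loop c.
Proof.
case/lastP: w => [|u c]; first by rewrite /loop_word /= loop_side.
by rewrite loop_word_rcons; exists u, c.
Qed.

Lemma extend_sides (w : word) d k : (size w <= k)%N -> ~~ loop (extend w d k).
Proof. by move=> wk; rewrite /extend nth_default // loop_side. Qed.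

Lemma circle_root (u : word) c : loop c -> valid_word (rcons u c) ->
  circle (rcons u c) (vertex u).
Proof.
move=> cl vuc; have ve : valid (extend (rcons u c) false).
  by apply: valid_extend => //; case: (u).
exists (extend (rcons u c) false); split=> //.
- exact: begins_extend.
- exact: extend_sides.
- apply: vertexE => //; exists false; apply: extend_rcons_tail.
  exact: loop_neq_side.
Qed.

Lemma circle_vertex (w : word) (x : stream) k : valid x -> begins w x -> w <> [::] ->
  (size w <= k)%N -> (forall i, (size w <= i < k)%N -> ~~ loop (x i)) ->
  circle w (vertex (prefix_word x k)).
Proof.
move=> vx wx w0 wk xs; set u := prefix_word x k.
have su : size u = k by rewrite size_mkseq.
have u0 : u <> [::] by move=> u0; move: wk; rewrite -su u0; case: (w) w0.
have vu : valid_word u by exact: valid_prefix.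
exists (vertex_stream u).
have ux : agree k x (vertex_stream u).
  by apply/agree_prefix; have [] := vertex_stream_tail u.
split=> //; first exact: valid_vertex_stream.
  exact: agree_begins ux wk wx.
move=> i wi; have [ik|ki] := ltnP i k.
  by rewrite -ux // xs // wi.
rewrite /vertex_stream; have -> : (if u is [::] then base_loop else side false)
  = side false.
  by case: (u) u0.
rewrite /extend nth_rcons su ltnNge ki /=; case: ifP => _; exact/negbT/loop_side.
Qed.

(** After [w] the addresses have no loop, so [glued_on_circle] applies at
    their first difference. *)
Lemma limit_coord_circle_inj (w : word) z t : loop_word w -> circle w z ->
  circle w t ->
  limit_coord w z = limit_coord w t -> z = t.
Proof.
move=> lw [x [vx wx xs <-]] [y [vy wy ys <-]]; rewrite !limit_coordE // => E.
apply/point_at_glued => //.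
have [->|xy] := pselect (x = y); first by left.
have [k ag xyk] := first_difference xy.
have wk : (size w <= k)%N.
  by rewrite leqNgt; apply/negP => kw; move/eqP: xyk; apply;
    exact: (begins_agree wx wy).
have [u [c [wE cl]]] := loop_word_split lw.
have su : size w = (size u).+1 by rewrite wE size_rcons.
have xu : loop (x (size u)).
  by move: wx; rewrite wE begins_rcons => /andP[_ /eqP ->].
have yu : loop (y (size u)).
  by move: wy; rewrite wE begins_rcons => /andP[_ /eqP ->].
have pre (s : stream) : begins w s -> prefix_word s (size u).+1 = w.
  by rewrite -su => /eqP.
have noloop (s : stream) : (forall k, (size w <= k)%N -> ~~ loop (s k)) ->
    const_after_loop s k /\ (forall i, (size u < i < k)%N -> ~~ loop (s i)).
  move=> ss; split=> [sk|i /andP[ui _]]; first by have := ss k wk; rewrite sk.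
  by apply: ss; rewrite su.
have [xk xi] := noloop x xs; have [yk yi] := noloop y ys.
have ku : (size u < k)%N by rewrite -su.
have tx := theta01 R (skip 1 (skip k x)).
have ty := theta01 R (skip 1 (skip k y)).
have := thetaE R (skip k x); have := thetaE R (skip k y).
rewrite {2}/skip addn0 {5}/skip addn0.
have := xs k wk; have := ys k wk.
case: (letterP (x k)) (xyk) => [->|->|->//]; case: (letterP (y k)) => [->|->|->//];
  rewrite ?eqxx ?halve_side //= => _ _ _ yE xE.
- apply: (glued_on_circle ag ku xu xi xk yk); first by lra.
  by rewrite pre.
- apply: glued_sym; apply: (glued_on_circle (agree_sym ag) ku yu yi yk xk);
  first by lra.
  by rewrite pre.
Qed.

Lemma limit_coord_circle_onto (w : word) : loop_word w -> valid_word w ->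
  limit_coord w @` circle w = @unit_circle R.
Proof.
move=> lw vw; apply/seteqP; split=> [_ [z _ <-]|p up]; first exact: limit_coord_unit.
have [t t01 tp] := circle_point_onto up.
have [s ss st] := theta_onto n t01.
have [u [c [wE cl]]] := loop_word_split lw.
pose x : stream := fun k => if (k < size w)%N then nth (side false) w k else s
  (k - size w)%N.
have wx : begins w x by apply/beginsP => k kw; rewrite /x kw.
have vx : valid x.
  move=> k; rewrite /x; case: ltnP => [|wk]; first exact: vw.
  have : ~~ loop (s (k - size w)%N) by [].
  case: (letterP (s (k - size w)%N)) => [->|->|->//] _ /=;
    by apply/esym/negbTE; rewrite -lt0n; apply: leq_trans wk; rewrite wE size_rcons.
exists (L x).
  exists x; split=> // k wk; rewrite /x ltnNge wk /=; exact: ss.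
rewrite limit_coordE // /stream_coord /angle lw wx /= -tp -st;
  congr circle_point; congr theta.
by apply/funext => j; rewrite /skip /x ltnNge leq_addr /= addKn.
Qed.

Lemma circle_compact (w : word) : compact (circle w).
Proof.
have -> : circle w = L @` ([set x | valid x] `&` [set x | begins w x] `&`
    [set x | forall k, (size w <= k)%N -> ~~ loop (x k)]).
  apply/seteqP; split=> [z [x [vx wx xs xz]]|z [x [[vx wx] xs] xz]]; by exists x.
apply: limit_image_compact; last by move=> x [[]].
apply: closedI; first by apply: closedI; [exact: valid_closed|exact: begins_closed].
apply: stream_closed => x /existsNP[k /not_implyP[wk xk]].
by exists k.+1 => y xy ys; apply: xk; rewrite xy //; exact: ys.
Qed.

Lemma circle_is_circle (w : word) : loop_word w -> valid_word w ->
  is_circle R (circle w).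
Proof.
move=> lw vw.
have [g fg] := compact_homeo (vertex [::]) (@circle_hausdorff R) (@circle_compact w)
  (@limit_coord_continuous w) (fun z t => @limit_coord_circle_inj w z t lw).
exists g, (limit_coord w); rewrite -(limit_coord_circle_onto lw vw).
exact: homeo_between_sym.
Qed.

(** The cell of the loop [x k] hangs from the circle of [w] at a single
    point. *)
Lemma limit_coord_cell_const (w : word) (x : stream) k z t : begins w x ->
  (size w <= k)%N ->
  loop (x k) -> cell (prefix_word x k.+1) z -> cell (prefix_word x k.+1) t ->
  limit_coord w z = limit_coord w t.
Proof.
move=> wx wk xk [y [vy xy <-]] [y' [vy' xy' <-]]; rewrite !limit_coordE //.
have ag := begins_agree xy xy'; rewrite size_mkseq in ag.
move/agree_prefix: xy => xy; move/agree_prefix: xy' => xy'.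
rewrite /stream_coord /angle (agree_begins xy (leq_trans wk (leqnSn _)) wx).
rewrite (agree_begins xy' (leq_trans wk (leqnSn _)) wx).
case: ifP => // _; congr circle_point; apply: (@eq_theta_skip _ _ (k - size w)%N).
  by move=> j jk; rewrite /skip ag //; lia.
rewrite !skipD subnKC // !theta_loop // /skip addn0.
  by rewrite -xy'.
by rewrite -xy.
Qed.

Lemma branch_neq_root (u : word) c z : valid_word (rcons u c) ->
  branch (rcons u c) z -> z <> vertex u.
Proof.
move=> /valid_rcons[vu _] zb zu; rewrite zu in zb.
by apply: branch_shorter_vertex zb; rewrite ?size_rcons.
Qed.

(** Let [w] be a word whose coordinate separates two points of [C], one of
    which is then in [branch w]. As [C] minus a point is connected, [C] minus
    the root stays in this branch. If [C] left [circle w] by another loop, it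
    would lie below this loop for the same reason, where the coordinate is
    constant. So [C] is contained in [circle w], and equal to it by
    [circle_onto]. *)
Lemma is_circleP (C : set X) : is_circle R C ->
  exists w, [/\ loop_word w, valid_word w & C = circle w].
Proof.
move=> cC; have [z1 [z2 [_ [[C1 C2 _] [z12 _ _]]]]] := circle_three_points cC.
have [w Ew] : exists w, limit_coord w z1 <> limit_coord w z2.
  by apply: contrapT => nw; apply: z12; apply: limit_coord_inj => w;
    apply: contrapT => E; apply: nw; exists w.
wlog z1w : z1 z2 C1 C2 z12 Ew / branch w z1.
  move=> W; have [z1w|nz1] := pselect (branch w z1); first exact: W Ew z1w.
  have [z2w|nz2] := pselect (branch w z2).
    by apply: W (nesym Ew) z2w => //; exact: nesym.
  have e1 : limit_coord w z1 = circle_point 0 by exact: contrapT.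
  have e2 : limit_coord w z2 = circle_point 0 by exact: contrapT.
  by case: Ew; rewrite e1 e2.
have [x [vx wx xz1]] := branch_sub_cell z1w.
have vw : valid_word w by exact: valid_begins wx.
have lw : loop_word w.
  apply: contrapT => /negP nl; apply: Ew.
  by rewrite /limit_coord /stream_coord /angle (negbTE nl).
have [u [c [wE cl]]] := loop_word_split lw.
have vuc : valid_word (rcons u c) by rewrite -wE.
have w0 : w <> [::] by rewrite wE; case: (u).
have sub : C `<=` circle w.
  move=> z Cz; have [zw|nzw] := pselect (cell w z); last first.
    have zu : z <> vertex u by move=> zu; apply: nzw; rewrite zu wE;
      exact: cell_parent.
    have : C `\ vertex u `<=` branch (rcons u c).
      apply: connected_branch => //; first exact: circleD1_connected cC.
        exists z1; rewrite -wE; split=> //; split=> //.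
        by apply: (branch_neq_root vuc); rewrite -wE.
      by move=> [_]; apply.
    by move=> /(_ z (conj Cz zu)); rewrite -wE => /branch_sub_cell.
  have [s [vs ws sz]] := zw.
  have [[k [wk sk]]|ns] := pselect (exists k, (size w <= k)%N /\ loop (s k));
    last first.
    by exists s; split=> // k wk; apply/negP => sk; apply: ns; exists k.
  have ex : exists k, (size w <= k)%N && loop (s k) by exists k; rewrite wk.
  case: (ex_minnP ex) => j /andP[wj sj] jmin {k wk sk ex}.
  pose v := prefix_word s j.
  have vE : prefix_word s j.+1 = rcons v (s j) by rewrite prefix_wordS.
  have vv : valid_word (rcons v (s j)) by rewrite -vE; exact: valid_prefix.
  have cv : circle w (vertex v).
    apply: circle_vertex ws w0 wj _ => //.
    move=> i /andP[wi ij]; apply/negP => si.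
    by have := jmin i; rewrite wi si => /(_ isT); rewrite leqNgt ij.
  have [->//|zv] := pselect (z = vertex v).
  have zb : branch (rcons v (s j)) z.
    apply: cell_branch => //; exists s; split=> //.
    by rewrite -vE; exact: begins_prefix.
  have Cb : C `\ vertex v `<=` branch (rcons v (s j)).
    apply: connected_branch => //; first exact: circleD1_connected cC.
      by exists z.
    by move=> [_]; apply.
  have Cc y : C y -> cell (prefix_word s j.+1) y.
    rewrite vE => Cy; have [->|yv] := pselect (y = vertex v);
      first exact: cell_parent.
    by apply: branch_sub_cell; exact: Cb.
  by case: Ew; apply: limit_coord_cell_const ws wj sj (Cc _ C1) (Cc _ C2).
exists w; split=> //; apply/seteqP; split=> // q cq.
have onto := circle_onto cC (@limit_coord_continuous w) (fun z _ =>
  limit_coord_unit w z)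
  (fun z t Cz Ct => limit_coord_circle_inj lw (sub _ Cz) (sub _ Ct)).
have : (limit_coord w @` C) (limit_coord w q) by rewrite onto;
  exact: limit_coord_unit.
by move=> [y Cy /(limit_coord_circle_inj lw (sub _ Cy) cq) <-].
Qed.

(** * Separation of circles and arcs *)

Lemma prefix_begins (w w' : word) (x : stream) : begins w x -> begins w' x ->
  (size w <= size w')%N -> prefix w w'.
Proof.
move=> wx w'x ww'; apply/prefixP; exists (drop (size w) w').
rewrite -[LHS](cat_take_drop (size w)); congr cat.
move/eqP: w'x => <-; move/eqP: (wx) => {2}<-.
by rewrite /prefix_word /mkseq -map_take take_iota (minn_idPl _).
Qed.

(** The loop that ends [w'] cannot occur in an address on the circle after the
    prefix [w]. *)
Lemma circle_not_branch (w w' : word) z : loop_word w' -> ~~ prefix w' w ->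
  circle w z -> ~ branch w' z.
Proof.
move=> lw' ww' [x [vx wx xs <-]]; rewrite /branch /= limit_coordE // => xw'.
have w'x : begins w' x by apply: contrapT => /negP nb; apply: xw';
  exact: stream_coord_not_begins.
have [w'w|ww] := leqP (size w') (size w).
  by case/negP: ww'; exact: prefix_begins w'x wx w'w.
have [u [c [wE cl]]] := loop_word_split lw'.
move: w'x ww; rewrite wE begins_rcons size_rcons ltnS => /andP[_ /eqP xu] wu.
by have := xs _ wu; rewrite xu cl.
Qed.

Lemma circleD1_sub_branch (u : word) c : loop c -> valid_word (rcons u c) ->
  circle (rcons u c) `\ vertex u `<=` branch (rcons u c).
Proof. by move=> cl vuc z [/circle_sub_cell zc zu]; exact: cell_branch. Qed.

Lemma circleD1_nonempty (C : set X) p : is_circle R C -> exists2 z, C z & z <> p.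
Proof.
move=> /circle_three_points[y [z [_ [[Cy Cz _] [yz _ _]]]]].
have [yp|yp] := pselect (y = p); last by exists y.
by exists z => // zp; apply: yz; rewrite yp zp.
Qed.

Lemma separated_circles (C C' : set X) (u : word) c : is_circle R C ->
  is_circle R C' ->
  loop c -> valid_word (rcons u c) ->
  C `\ vertex u `<=` branch (rcons u c) ->
  (forall z, C' z -> ~ branch (rcons u c) z) ->
  exists K K', [/\ complement_components (vertex u) K,
    complement_components (vertex u) K', K <> K',
    C `\ vertex u `<=` K & C' `\ vertex u `<=` K'].
Proof.
move=> cC cC' cl vuc Cb C'b.
have [z Cz zu] := circleD1_nonempty (vertex u) cC.
have [z' Cz' zu'] := circleD1_nonempty (vertex u) cC'.
have in_comp (D : set X) y : is_circle R D -> D y -> y <> vertex u ->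
    D `\ vertex u `<=` connected_component (~` [set vertex u]) y.
  move=> cD Dy yu; apply: connected_component_max; last exact: circleD1_connected cD.
    by split.
  by move=> t [_].
exists (connected_component (~` [set vertex u]) z).
exists (connected_component (~` [set vertex u]) z'); split.
- by exists z.
- by exists z'.
- move=> E; apply: (C'b z' Cz').
  apply: (joined_branch cl vuc (Cb z (conj Cz zu))).
  by rewrite /joined E; exact: connected_component_refl.
- exact: in_comp.
- exact: in_comp.
Qed.

(** One of the two words is not a prefix of the other; the root of its circle
    separates the circles. *)
Lemma circles_separated (C C' : set X) : is_circle R C -> is_circle R C' -> C <> C' ->
  exists x K K', [/\ cut_point x, complement_components x K,
    complement_components x K', K <> K' & (C `\ x `<=` K) /\ (C' `\ x `<=` K')].
Proof.
move=> cC cC' CC'.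
have [w [lw vw CE]] := is_circleP cC; have [w' [lw' vw' CE']] := is_circleP cC'.
have ww' : w <> w' by move=> ww'; apply: CC'; rewrite CE CE' ww'.
have main D D' v v' : is_circle R D -> is_circle R D' -> loop_word v ->
  valid_word v ->
    D = circle v -> D' = circle v' -> ~~ prefix v v' ->
    exists x K K', [/\ cut_point x, complement_components x K,
      complement_components x K', K <> K' & (D `\ x `<=` K) /\ (D' `\ x `<=` K')].
  move=> cD cD' lv vv DE DE' vv'.
  have [u [c [vE cl]]] := loop_word_split lv; rewrite vE in vv.
  have [||K [K' [pK pK' KK' DK DK']]] := separated_circles cD cD' cl vv.
  - by rewrite DE vE; exact: circleD1_sub_branch.
  - by rewrite DE' -vE => z; exact: circle_not_branch.
  exists (vertex u), K, K'; split=> //; apply: vertex_cut_point.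
  by have [] := (valid_rcons u c).1 vv.
have [pww'|nww'] := boolP (prefix w w'); last exact: main CE CE' nww'.
have nww' : ~~ prefix w' w.
  apply/negP => pw'w; apply: ww'; apply: prefix_size_eq => //.
  by apply/eqP; rewrite eqn_leq !size_prefix.
have [x [K [K' [cx xK xK' KK' [CK CK']]]]] := main _ _ _ _ cC' cC lw' vw' CE' CE nww'.
by exists x, K', K; split=> //; exact: nesym.
Qed.

(** The circle that contains the edge [u], and one that hangs from the vertex
    [u]. *)
Lemma vertex_two_circles (u : word) : valid_word u -> u <> [::] ->
  exists C C', [/\ is_circle R C, is_circle R C', C <> C',
    C (vertex u) & C' (vertex u)].
Proof.
move=> vu u0.
pose x := vertex_stream u.
have vx : valid x by exact: valid_vertex_stream.
have ux : begins u x by have [] := vertex_stream_tail u.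
have n1 : (0 < n.-1)%N by case: (n) n_gt1 => [|[]].
pose c : letter :=
  inr (@Tagged _ tt (fun c => edge (repl (r:=S) c)) (inr (Ordinal n1))).
have cl : loop c by apply/forallP => d; rewrite eq_side.
have vuc : valid_word (rcons u c) by apply/valid_rcons; split=> //; case: (u) u0.
have lu : (0 < size u)%N by case: (u) u0.
have [j [ju xj xi]] := last_loop vx lu.
pose w := prefix_word x j.+1.
have lw : loop_word w by rewrite /w prefix_wordS loop_word_rcons.
have vw : valid_word w by exact: valid_prefix.
have luc : loop_word (rcons u c) by rewrite loop_word_rcons.
exists (circle (rcons u c)), (circle w); split.
- exact: circle_is_circle.
- exact: circle_is_circle.
- move=> E; have cv : circle (rcons u c) (vertex (rcons u c)).
    have := @circle_vertex (rcons u c) (vertex_stream (rcons u c)) (size (rcons u c)).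
    have [b _ _] := vertex_stream_tail (rcons u c); rewrite (eqP b); apply=> //.
    + exact: valid_vertex_stream.
    + by case: (u).
    + by move=> i; lia.
  have := branch_vertex cl vuc; apply: (@circle_not_branch w) => //.
    by apply/negP => /size_prefix; rewrite /w size_mkseq size_rcons ltnS leqNgt ju.
  by rewrite -E.
- exact: circle_root.
- have -> : u = prefix_word x (size u) by rewrite (eqP ux).
  apply: circle_vertex => //; rewrite ?begins_prefix ?size_mkseq //.
Qed.

Lemma double_points_dense :
  dense [set x : X | exists C C',
    [/\ is_circle R C, is_circle R C', C <> C', C x & C' x]].
Proof.
move=> O [z Oz] oO; have [k kO] := cells_small oO Oz.
have [w [vw wk wz]] := cell_cover z k.+1.
exists (vertex w); split.
  by apply: kO (cell_vertex vw) => //; rewrite wk.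
by apply: vertex_two_circles => // w0; rewrite w0 in wk.
Qed.

(** An arc that enters a branch and leaves it passes twice through its
    root. *)
Lemma arc_through (x y z : X) (A : set X) (u : word) c : arc_between R x y A -> A z ->
  loop c -> valid_word (rcons u c) ->
  ~ branch (rcons u c) x -> ~ branch (rcons u c) y ->
  ~ branch (rcons u c) z.
Proof.
move=> [f [g [fg f0 f1]]] Az cl vuc xb yb zb.
have [_ _ fA gA] := fg; have [t01 fgz] := gA z Az; rewrite /= in t01.
set t := g z in t01 fgz.
have f_inj a b : 0 <= a <= 1 -> 0 <= b <= 1 -> f a = f b -> a = b.
  by move=> /fA[_ {2}<-] /fA[_ {2}<-] ->.
have through (a b : R) : 0 <= a -> b <= 1 -> a <= t <= b ->
    (exists2 s, a <= s <= b & ~ branch (rcons u c) (f s)) ->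
    exists2 s, a <= s <= b & f s = vertex u.
  move=> a0 b1 tab [s sab sb]; apply: contrapT => ns; apply: sb.
  have : f @` `[a, b] `<=` branch (rcons u c); last first.
    by apply; exists s => //=; rewrite in_itv.
  have nu : ~ (f @` `[a, b]) (vertex u).
    by move=> [r /= + fr]; rewrite in_itv /= => rab; apply: ns; exists r.
  apply: (connected_branch cl vuc) nu.
  - apply: (homeo_image fg); last exact: segment_connected.
    by move=> r /=; rewrite in_itv /= => rab; lra.
  - by exists z; split=> //; exists t => //=; rewrite in_itv.
have [||||s1 s1t fs1] := through 0 t; [by []|lra|lra|by exists 0; [lra|rewrite f0]|].
have [||||s2 s2t fs2] := through t 1; [lra|by []|lra|by exists 1; [lra|rewrite f1]|].
have s12 : s1 = s2 by apply: f_inj; rewrite ?fs1 ?fs2 //; lra.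
have s1E : s1 = t by lra.
by apply: (branch_neq_root vuc zb); rewrite -fgz -s1E.
Qed.

(** The circles are those of the loop words that are prefixes of [u] or [v],
    where the ends of the arc are on the circles of [u] and [v]. At a point
    off these circles, the first loop of the address that does not belong to
    [u] or [v] leads into a branch that contains neither end of the arc. *)
Lemma arc_circles (x y : X) : (exists2 C, is_circle R C & C x) ->
  (exists2 C, is_circle R C & C y) ->
  forall A, arc_between R x y A -> exists F : set (set X), [/\ finite_set F,
    (forall C, F C -> is_circle R C) & A `<=` \bigcup_(C in F) C].
Proof.
move=> [C /is_circleP[u [lu vu ->]] ux] [C' /is_circleP[v [lv vv ->]] vy] A arcA.
pose Q (w : word) := [/\ loop_word w, valid_word w & prefix w u \/ prefix w v].
exists [set circle w | w in Q]; split.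
- pose prefixes (w : word) := [seq take k w | k <- iota 0 (size w).+1].
  apply: finite_image; apply: (@sub_finite_set _ _ [set` prefixes u ++ prefixes v]);
    last exact: finite_seq.
  have take_in (w v' : word) : prefix w v' -> w \in prefixes v'.
    move=> wv; apply/mapP; exists (size w); first by rewrite mem_iota /= ltnS
      size_prefix.
    by move/prefixP: wv => [t ->]; rewrite take_size_cat.
  by move=> w [_ _ [] /take_in wp]; rewrite /mkset mem_cat wp ?orbT.
- by move=> _ [w [lw vw _] <-]; exact: circle_is_circle.
move=> z Az; have [s vs sz] := point_at_onto n_gt1 z.
have s0 : loop (s 0%N) by apply: loop_base; rewrite vs.
have vsp k : valid_word (prefix_word s k) by exact: valid_prefix.
have lsp k : loop (s k) -> loop_word (prefix_word s k.+1).
  by move=> sk; rewrite prefix_wordS loop_word_rcons.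
pose bad j := loop (s j) && ~~ (prefix (prefix_word s j.+1) u ||
  prefix (prefix_word s j.+1) v).
have goodQ j : loop (s j) -> ~~ bad j -> Q (prefix_word s j.+1).
  by move=> sj; rewrite /bad sj negbK => /orP h; split=> //; exact: lsp.
have [ex|nex] := pselect (exists j, bad j); last first.
  have good j : ~~ bad j by apply/negP => bj; apply: nex; exists j.
  (* The loops of [s] are then bounded in depth, and [z] is on the circle of the
   last one. *)
pose m := maxn (size u) (size v).
  have small j : loop (s j) -> (j < m)%N.
    move=> sj; have [_ _ [] /size_prefix] := goodQ j sj (good j);
      by rewrite size_mkseq /m leq_max => ->; rewrite ?orbT.
  have m0 : (0 < m)%N by exact: leq_ltn_trans (small 0%N s0).
  have [j [jm sj si]] := last_loop vs m0.
  exists (circle (prefix_word s j.+1)); first by exists (prefix_word s j.+1) =>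
    //; exact: goodQ.
  exists s; split=> //; first exact: begins_prefix.
  move=> k; rewrite size_mkseq => jk; apply/negP => sk.
  by have := si k; rewrite jk (small k sk) sk => /(_ isT).
case: (ex_minnP ex) => j bj jmin; have /andP[sj nj] := bj.
pose w := prefix_word s j.
have wE : prefix_word s j.+1 = rcons w (s j) by rewrite prefix_wordS.
have vw : valid_word (rcons w (s j)) by rewrite -wE.
have nb r (w' : word) : circle w' r -> prefix (rcons w (s j)) w' = false ->
    ~ branch (rcons w (s j)) r.
  by move=> cr nw'; apply: circle_not_branch cr; rewrite ?nw' ?loop_word_rcons.
rewrite negb_or wE in nj; case/andP: nj => /negbTE nu /negbTE nv.
have zb := arc_through arcA Az sj vw (nb _ _ ux nu) (nb _ _ vy nv).
(* The point is thus the root of that loop, which is on one of the circles. *)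
have -> : z = vertex w.
  apply: contrapT => zw; apply: zb; apply: cell_branch => //.
  by exists s; split=> //; rewrite -wE; exact: begins_prefix.
have [j0|j0] := posnP j.
  have [u' [c [uE cl]]] := loop_word_split lu.
  have u0 : (0 < size u)%N by rewrite uE size_rcons.
  have [t [vt tu _ _]] := ux.
  have t0 : loop (t 0%N) by apply: loop_base; rewrite vt.
  have vt1 : valid_word (rcons [::] (t 0%N)) := valid_prefix (k := 1%N) vt.
  exists (circle (rcons [::] (t 0%N))).
    exists (rcons [::] (t 0%N)) => //; split=> //; left.
    by apply: prefix_begins (begins_prefix t 1) tu _; rewrite size_mkseq.
  by rewrite /w j0; exact: circle_root.
have [i [ij si sk]] := last_loop vs j0.
have Qi : Q (prefix_word s i.+1).
  by apply: goodQ => //; apply/negP => /jmin; rewrite leqNgt ij.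
exists (circle (prefix_word s i.+1)); first by exists (prefix_word s i.+1).
by apply: circle_vertex => //; rewrite ?begins_prefix ?size_mkseq.
Qed.

End Cells.

Theorem propositionC10 (R : realType) (n : nat) (hn : (2 <= n)%N) :
  regular_rabbit R (limit_space (rabbit_system n)) n.
Proof.
split; last exact: (cut_point_has_order R hn).
split.
- split; first exact: limit_compact hn.
  + exact: limit_metrizable hn.
  + exact: (limit_connected R hn).
  + exact: (limit_locally_connected R hn).
- exact: (double_points_dense R hn).
- exact: (circles_separated hn).
- exact: (arc_circles hn).
Qed.
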